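(* Let $X\subseteq\mathbb C^n$ be an irreducible variety with $\mathrm{EDdeg}(X)>0$. Then the ED polynomial $f_u(\epsilon)\in\mathbb C[u,\epsilon]$ has degree exactly $2\cdot\mathrm{EDdeg}(X)$ in the variable $\epsilon$.
   Context: For $x,y\in\mathbb C^n$, $x\cdot y=\sum_{i=1}^n x_iy_i$ (complex bilinear), and $d_u(x)=(u-x)\cdot(u-x)$. For $x\in X_{\mathrm{reg}}$ (smooth locus), $N_xX$ is the span of gradients at $x$ of generators of the ideal of $X$. The ED correspondence $\mathcal E_X\subseteq\mathbb C^n\times\mathbb C^n$ is the Zariski closure of $\{(x,u):x\in X_{\mathrm{reg}},\ u-x\in N_xX\}$; $\mathrm{EDdeg}(X)$ is the cardinality of the fiber over generic $u$ of $(x,u)\mapsto u$ on $\mathcal E_X$ if this map is dominant, and $0$ otherwise. When $\mathrm{EDdeg}(X)>0$, the Zariski closure of the image of $\mathcal E_X\to\mathbb C^n\times\mathbb C$, $(x,u)\mapsto(u,d_u(x))$, is an irreducible hypersurface cut out by an irreducible polynomial $F_u(R)\in\mathbb C[u,R]$ (unique up to scalar); the ED polynomial is $f_u(\epsilon)=F_u(\epsilon^2)$. *)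

(* Defs.v *)
From HB Require Import structures.
From mathcomp Require Import all_boot all_order all_algebra.
From mathcomp Require Import mpoly.
From mathcomp Require Import complex.
From mathcomp Require Import Rstruct.
From Stdlib Require Rdefinitions.

Set Implicit Arguments.
Unset Strict Implicit.
Unset Printing Implicit Defensive.

Import Order.TTheory GRing.Theory Num.Theory.
Local Open Scope ring_scope.

Definition CC : Type := complex Rdefinitions.R.

Definition vanishes_on (m : nat) (A : ('I_m -> CC) -> Prop) (p : {mpoly CC[m]}) : Prop :=
  forall a, A a -> p.@[a] = 0.

Definition zclosure (m : nat) (A : ('I_m -> CC) -> Prop) : ('I_m -> CC) -> Prop :=
  fun v => forall p : {mpoly CC[m]}, vanishes_on A p -> p.@[v] = 0.

Definition zclosed (m : nat) (A : ('I_m -> CC) -> Prop) : Prop :=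
  forall v, zclosure A v -> A v.

Definition irreducible_variety (m : nat) (X : ('I_m -> CC) -> Prop) : Prop :=
  [/\ zclosed X, exists x, X x &
      forall Y Z : ('I_m -> CC) -> Prop, zclosed Y -> zclosed Z ->
        (forall x, X x <-> (Y x \/ Z x)) ->
        (forall x, X x <-> Y x) \/ (forall x, X x <-> Z x)].

Definition jacobian (m k : nat) (ps : 'I_k -> {mpoly CC[m]}) (x : 'I_m -> CC)
  : 'M[CC]_(k, m) :=
  \matrix_(i < k, j < m) ((ps i)^`M(j)).@[x].

(* Smooth locus X_reg (Jacobian criterion): points of X at which the rank of the
   Jacobian of (generators of) I(X) is maximal among all points of X. *)
Definition regular_point (m : nat) (X : ('I_m -> CC) -> Prop) (x : 'I_m -> CC) : Prop :=
  X x /\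
  forall y, X y ->
  forall k (ps : 'I_k -> {mpoly CC[m]}), (forall i, vanishes_on X (ps i)) ->
  exists k' (ps' : 'I_k' -> {mpoly CC[m]}),
    (forall i, vanishes_on X (ps' i)) /\ leq (\rank (jacobian ps y)) (\rank (jacobian ps' x)).

Definition in_normal_space (m : nat) (X : ('I_m -> CC) -> Prop) (x w : 'I_m -> CC) : Prop :=
  exists k (ps : 'I_k -> {mpoly CC[m]}) (c : 'I_k -> CC),
    (forall i, vanishes_on X (ps i)) /\
    forall j : 'I_m, w j = \sum_(i < k) c i * ((ps i)^`M(j)).@[x].

Definition pairpt (n : nat) (x u : 'I_n -> CC) : 'I_(n + n) -> CC :=
  fun i => match split i with inl j => x j | inr j => u j end.

Definition ED_corr (n : nat) (X : ('I_n -> CC) -> Prop) : ('I_(n + n) -> CC) -> Prop :=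
  zclosure (fun v : 'I_(n + n) -> CC =>
    let x := fun j => v (lshift n j) in
    let u := fun j => v (rshift n j) in
    regular_point X x /\ in_normal_space X x (fun j => u j - x j)).

(* EDdeg(X) = d : over a generic u (outside a proper hypersurface g = 0), the fiber
   {x | (x,u) ∈ E_X} has exactly d points. (If the projection is not dominant the
   generic fiber is empty, so this gives d = 0, matching the convention.) *)
Definition EDdeg_is (n : nat) (X : ('I_n -> CC) -> Prop) (d : nat) : Prop :=
  exists g : {mpoly CC[n]}, g != 0 /\
    forall u : 'I_n -> CC, g.@[u] != 0 ->
      exists s : seq {ffun 'I_n -> CC},
        [/\ uniq s, size s = d &
            forall x : {ffun 'I_n -> CC}, ED_corr X (pairpt x u) <-> x \in s].

Definition sqdist (n : nat) (u x : 'I_n -> CC) : CC :=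
  \sum_(i < n) (u i - x i) ^+ 2.

Definition ED_hypersurface (n : nat) (X : ('I_n -> CC) -> Prop) : ('I_n.+1 -> CC) -> Prop :=
  zclosure (fun w : 'I_n.+1 -> CC =>
    exists x u : 'I_n -> CC,
      [/\ ED_corr X (pairpt x u), (forall j : 'I_n, w (lift ord_max j) = u j) &
          w ord_max = sqdist u x]).

Definition irreducible_mpoly (m : nat) (F : {mpoly CC[m]}) : Prop :=
  (1 < msize F)%N /\
  forall a b : {mpoly CC[m]}, F = a * b -> (msize a <= 1)%N \/ (msize b <= 1)%N.

Definition is_ED_defining_poly (n : nat) (X : ('I_n -> CC) -> Prop) (F : {mpoly CC[n.+1]}) : Prop :=
  irreducible_mpoly F /\ forall w : 'I_n.+1 -> CC, F.@[w] = 0 <-> ED_hypersurface X w.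

Definition ED_poly (n : nat) (F : {mpoly CC[n.+1]}) : {mpoly CC[n.+1]} :=
  F \mPo [tuple (if i == ord_max then 'X_i ^+ 2 else 'X_i) | i < n.+1].

Definition deg_in (m : nat) (i : 'I_m) (p : {mpoly CC[m]}) : nat :=
  \max_(mo <- msupp p) mo i.

(* Main.v *)
Require Import Defs.
From HB Require Import structures.
From mathcomp Require Import all_boot all_order all_algebra.
From mathcomp Require Import mpoly.
From mathcomp Require Import complex.
From mathcomp Require Import Rstruct.
From mathcomp Require Import ring separable.
From Stdlib Require Import Classical FunctionalExtensionality.

Set Implicit Arguments.
Unset Strict Implicit.
Unset Printing Implicit Defensive.

Import Order.TTheory GRing.Theory Num.Theory.
Local Open Scope ring_scope.

(** The vanishing ideal [P] of the pairs [(x, u)] with [x] regular and [u - x]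
    normal is prime, and it contains no nonzero polynomial in [u] alone because
    [EDdeg X > 0]. In characteristic 0 the derivation [d/du_j] therefore extends,
    up to a denominator outside [P], to a polynomial vector field preserving [P].
    Applying it to [F (u, R)], where [R] is the squared distance, gives
    [dF/du_j + 2 (u_j - x_j) dF/dR = 0] on [E], since [u - x] is orthogonal to
    the variation of [x]. By Gauss' lemma the irreducible [F] is coprime to
    [dF/dR] over [C(u)], so that for generic [u] the point [x] is a rational
    function of [(u, R)]. As the zeros of [F] are the closure of the image of
    [E], this rational function is inverse to [x |-> R] between the fiber of [E]
    and the roots of [F (u, -)], which are simple and [deg_R F] in number. *)

(** * Unique factorization in polynomial rings *)

Definition rdvd (D : comNzRingType) (a b : D) : Prop := exists c, b = a * c.

Definition prime_elt (D : idomainType) (p : D) : Prop :=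
  [/\ p != 0, p \isn't a GRing.unit &
      forall a b, rdvd p (a * b) -> rdvd p a \/ rdvd p b].

Definition factored (D : idomainType) (a : D) (ps : seq D) : Prop :=
  (forall p, p \in ps -> prime_elt p) /\
  exists2 u, u \is a GRing.unit & a = u * \prod_(p <- ps) p.

(** Prime rather than irreducible factors: uniqueness up to units is then automatic. *)
Definition is_ufd (D : idomainType) : Prop :=
  forall a : D, a != 0 -> exists ps, factored a ps.

Lemma prime_elt_unitM (D : idomainType) (p u : D) :
  u \is a GRing.unit -> prime_elt p -> prime_elt (u * p).
Proof.
move=> Uu [p0 pU pP]; have dv x : rdvd (u * p) x <-> rdvd p x.
  split=> -[c ->]; first by exists (u * c); rewrite mulrCA mulrA.
  by exists (u^-1 * c); rewrite mulrACA mulrV // mul1r.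
split=> [||a b /dv/pP]; rewrite ?dv //.
  by rewrite mulf_neq0 //; apply: contraTneq Uu => ->; rewrite unitr0.
by rewrite unitrM Uu.
Qed.

(** By primality [p] divides some factor [q = p * z]. As [q] is prime it divides [p], making [z] a
    unit, or it divides [z], which would make [p] a unit. *)
Lemma prime_dvd_factored (D : idomainType) (p a : D) (ps : seq D) :
  prime_elt p -> factored a ps -> rdvd p a ->
  exists2 q, q \in ps & exists2 v, v \is a GRing.unit & q = p * v.
Proof.
move=> pP [psP [u Uu ->{a}]]; have [p0 pU pM] := pP.
elim: ps psP => [|q ps IH] psP.
  rewrite big_nil mulr1 => -[c uE]; move: Uu; rewrite uE unitrM.
  by rewrite (negPf pU).
rewrite big_cons mulrCA => /pM[[z qE]|/IH]; last first.
  case=> [r rin|r rin rE]; first by apply: psP; rewrite inE rin orbT.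
  by exists r => //; rewrite inE rin orbT.
exists q; rewrite ?mem_head //; exists z => //.
have [q0 qU qM] := psP q (mem_head _ _).
have : rdvd q (p * z) by exists 1; rewrite mulr1.
case/qM=> -[w wE].
  have e : z * w = 1 by apply: (mulfI q0); rewrite mulr1 mulrCA -wE mulrC -qE.
  by apply/unitrP; exists w; rewrite [w * z]mulrC e.
case/negP: pU; apply/unitrP; exists w.
suff e : p * w = 1 by rewrite [w * p]mulrC e.
by apply: (mulfI q0); rewrite mulr1 mulrCA -wE.
Qed.

(** Induction on [size f + size g]: [p] divides the product of the leading coefficients, hence one
    of them, and that leading term can be subtracted without affecting divisibility by [p]. *)
Lemma prime_polyC (D : idomainType) (p : D) :
  prime_elt p -> prime_elt (p%:P : {poly D}).
Proof.
move=> [p0 pU pM]; split; first by rewrite polyC_eq0.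
  by rewrite poly_unitE coefC eqxx (negPf pU) andbF.
move=> f g; have [N] := ubnP (size f + size g).
elim: N f g => // N IH f g; rewrite ltnS => ltN [z fgE].
have [->|f0] := eqVneq f 0; first by left; exists 0; rewrite mulr0.
have [->|g0] := eqVneq g 0; first by right; exists 0; rewrite mulr0.
have cut (h : {poly D}) c : h != 0 -> lead_coef h = p * c ->
    let h' := h - p%:P * (c *: 'X^((size h).-1)) in
    (size h' < size h)%N /\ (rdvd p%:P h' -> rdvd p%:P h).
  move=> h0 hE h'; split; last first.
    by case=> y yE; exists (y + c *: 'X^((size h).-1)); rewrite mulrDr -yE subrK.
  rewrite -[X in (_ < X)%N]prednK ?size_poly_gt0 // ltnS.
  apply/leq_sizeP=> j le_j; rewrite /h' coefB coefCM coefZ coefXn.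
  have [->|ne_j] := eqVneq j (size h).-1; first by rewrite mulr1 -hE lead_coefE subrr.
  rewrite !mulr0 subr0 nth_default //.
  by rewrite -[size h]prednK ?size_poly_gt0 // ltn_neqAle eq_sym ne_j.
have : rdvd p (lead_coef f * lead_coef g).
  by exists (lead_coef z); rewrite -lead_coefM fgE lead_coefM lead_coefC.
case/pM=> -[c cE].
  have [lth back] := cut f c f0 cE.
  case: (IH (f - p%:P * (c *: 'X^((size f).-1))) g).
  - by apply: leq_trans ltN; rewrite ltn_add2r.
  - by exists (z - c *: 'X^((size f).-1) * g); rewrite mulrBl fgE mulrBr mulrA.
  - by move/back; left.
  - by right.
have [lth back] := cut g c g0 cE.
case: (IH f (g - p%:P * (c *: 'X^((size g).-1)))).
- by apply: leq_trans ltN; rewrite ltn_add2l.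
- exists (z - f * (c *: 'X^((size g).-1))); rewrite mulrBr fgE mulrBr.
  by congr (_ - _); rewrite mulrCA.
- by left.
- by move/back; right.
Qed.

(** * Gauss' lemma and factorization over a factorial domain *)

Section Gauss.

Variable D : idomainType.
Hypothesis factD : is_ufd D.
Implicit Types f g a b t : {poly D}.

(** The primes of [c] are cancelled one at a time: each remains prime as a constant polynomial, so
    it divides [a] or [b], and dividing by it preserves sizes. *)
Lemma clear_denominator c f a b : c != 0 -> c%:P * f = a * b ->
  exists a' b', [/\ f = a' * b', size a' = size a & size b' = size b].
Proof.
move=> /factD[ps [psP [u Uu ->{c}]]].
elim: ps psP a b => [|p ps IH] psP a b.
  rewrite big_nil mulr1 => E; exists (u^-1%:P * a), b; split=> //.
    by rewrite -mulrA -E mulrA -polyCM mulVr // mul1r.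
  by rewrite size_Cmul // invr_eq0; apply: contraTneq Uu => ->; rewrite unitr0.
rewrite big_cons mulrCA polyCM -mulrA => E.
have [p0 _ _] := psP p (mem_head _ _).
have p0' : p%:P != 0 :> {poly D} by rewrite polyC_eq0.
have [_ _ pM] := prime_polyC (psP p (mem_head _ _)).
have ps'P q : q \in ps -> prime_elt q by move=> qin; apply: psP; rewrite inE qin orbT.
have : rdvd p%:P (a * b) by rewrite -E; eexists.
case/pM=> -[z zE].
  have E' : p%:P * ((u * \prod_(j <- ps) j)%:P * f) = p%:P * (z * b).
    by rewrite E zE mulrA.
  have [a' [b' [-> sa sb]]] := IH ps'P z b (mulfI p0' E').
  by exists a', b'; rewrite sa sb zE size_Cmul.
have E' : p%:P * ((u * \prod_(j <- ps) j)%:P * f) = p%:P * (a * z).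
  by rewrite E zE mulrCA.
have [a' [b' [-> sa sb]]] := IH ps'P a z (mulfI p0' E').
by exists a', b'; rewrite sa sb zE size_Cmul.
Qed.

Definition primitive f := forall p : D, prime_elt p -> ~ rdvd p%:P f.

(** Each prime of [c] divides [f * t] but not [f], so it can be cancelled from the cofactor [t]. *)
Lemma primitive_dvd c f a : primitive f -> c != 0 -> rdvd f (c%:P * a) -> rdvd f a.
Proof.
move=> prim /factD[ps [psP [u Uu ->{c}]]] [t].
elim: ps psP t => [|p ps IH] psP t.
  rewrite big_nil mulr1 => E; exists (u^-1%:P * t).
  by rewrite mulrCA -E mulrA -polyCM mulVr // mul1r.
rewrite big_cons mulrCA polyCM -mulrA => E.
have pP := psP p (mem_head _ _); have [p0 _ _] := pP.
have p0' : p%:P != 0 :> {poly D} by rewrite polyC_eq0.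
have [_ _ pM] := prime_polyC pP.
have : rdvd p%:P (f * t) by rewrite -E; eexists.
case/pM=> [/(prim p pP)//|[z zE]].
apply: (IH _ z) => [q qin|]; first by apply: psP; rewrite inE qin orbT.
by apply: (mulfI p0'); rewrite E zE mulrCA.
Qed.

(** The last hypothesis is irreducibility over the fraction field with denominators cleared. If the
    gcd of [f] and [a] is constant, Bezout shows that [f] divides a nonzero constant times [b];
    otherwise [f] agrees with the gcd up to constants and divides a constant times [a]. Primitivity
    removes the constants. *)
Lemma primitive_prime f : primitive f -> (1 < size f)%N ->
  (forall c a b, c != 0 -> c%:P * f = a * b -> (1 < size a)%N -> (size b <= 1)%N) ->
  prime_elt f.
Proof.
move=> prim sf irr; have f0 : f != 0 by rewrite -size_poly_gt0 ltnW.
split=> //; first by rewrite poly_unitE (gtn_eqF sf).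
move=> a b [w wE]; have gf := dvdp_gcdl f a; have ga := dvdp_gcdr f a.
have [[c q] /= c0 qE] := Pdiv.Idomain.dvdpP _ _ gf.
have [[e r] /= e0 rE] := Pdiv.Idomain.dvdpP _ _ ga.
rewrite -!mul_polyC in qE rE.
have g0 : gcdp f a != 0 by rewrite gcdp_eq0 negb_and f0.
have [sg|sg] := leqP (size (gcdp f a)) 1.
  have [[u v] /=] := Bezoutp f a.
  have [d dE] : exists d, gcdp f a = d%:P by exists (gcdp f a)`_0; apply: size1_polyC.
  have d0 : d != 0 by rewrite -polyC_eq0 -dE.
  rewrite dE => /eqpP[[k l] /= /andP[k0 l0] E].
  right; apply: (@primitive_dvd (l * d)) => //; first by rewrite mulf_neq0.
  exists (k%:P * (u * b + v * w)).
  rewrite polyCM mul_polyC -E -mul_polyC.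
  have -> : f * (k%:P * (u * b + v * w)) = k%:P * (u * f * b + v * (f * w)) by ring.
  by rewrite -wE; ring.
have := irr c (gcdp f a) q c0; rewrite qE mulrC => /(_ erefl sg) sq.
have [d dE] : exists d, q = d%:P by exists q`_0; apply: size1_polyC.
have d0 : d != 0.
  rewrite -(polyC_eq0 d) -dE; apply: contra_neq f0 => q0; apply/eqP.
  by move/eqP: qE; rewrite q0 mul0r mulf_eq0 polyC_eq0 (negPf c0).
left; apply: (@primitive_dvd (d * e)) => //; first by rewrite mulf_neq0.
by exists (r * c%:P); rewrite polyCM -mulrA rE mulrCA -dE -qE; ring.
Qed.

Lemma factored_prime (A : idomainType) (p : A) : prime_elt p -> factored p [:: p].
Proof.
move=> pP; split=> [q|]; first by rewrite inE => /eqP ->.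
by exists 1; rewrite ?unitr1 // big_seq1 mul1r.
Qed.

Lemma factoredM (A : idomainType) (a b : A) ps qs :
  factored a ps -> factored b qs -> factored (a * b) (ps ++ qs).
Proof.
move=> [psP [u Uu ->]] [qsP [v Uv ->]]; split=> [q|].
  by rewrite mem_cat => /orP[/psP|/qsP].
by exists (u * v); rewrite ?unitrM ?Uu // big_cat /= mulrACA.
Qed.

(** Outer induction on the size of [f], inner induction on the number of primes of its leading
    coefficient. A constant prime divisor shortens that list, a splitting into nonconstant factors
    lowers the size, and a nonconstant [f] admitting neither is prime. *)
Theorem ufd_poly : is_ufd {poly D}.
Proof.
move=> f; have [N] := ubnP (size f); elim: N f => // N IH f ltN f0.
have [qs qsP] : exists qs, factored (lead_coef f) qs by apply: factD; rewrite lead_coef_eq0.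
have [k] := ubnP (size qs); elim: k f qs ltN f0 qsP => // k IHk f qs ltN f0 qsP ltk.
have [[p [pP [f1 fE]]]|prim] := classic (exists p, prime_elt p /\ rdvd p%:P f).
  have [p0 _ _] := pP.
  have lcE : lead_coef f = p * lead_coef f1 by rewrite fE lead_coefM lead_coefC.
  have [q qin [v Uv qE]] : exists2 q, q \in qs & exists2 v, v \is a GRing.unit & q = p * v.
    by apply: (prime_dvd_factored pP qsP); exists (lead_coef f1).
  have [ps psP] : exists ps, factored f1 ps.
    apply: (IHk f1 (rem q qs)).
    - by rewrite fE size_Cmul in ltN.
    - by apply: contra_neq f0 => f10; rewrite fE f10 mulr0.
    - case: qsP => qsP [u Uu lE]; split=> [r /mem_rem/qsP//|].
      exists (u * v); first by rewrite unitrM Uu.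
      by apply: (mulfI p0); rewrite -lcE lE (big_rem _ qin) /= qE; ring.
    - by rewrite size_rem // prednK // -?has_predT; case: (qs) qin ltk.
  by exists ([:: p%:P] ++ ps); rewrite fE; apply: factoredM (factored_prime (prime_polyC pP)) psP.
have {}prim : primitive f by move=> p pP dv; apply: prim; exists p.
(* A primitive constant has no prime factor, so it is a unit. *)
have [sf|sf] := leqP (size f) 1.
  have fE := size1_polyC sf; move: fE qsP; set c := f`_0 => fE.
  rewrite fE lead_coefC => -[]; case: qs {ltk} => [|p qs] psP [u Uu cE]; last first.
    exfalso; apply: (prim p); first by apply: psP; rewrite mem_head.
    exists (u * \prod_(j <- qs) j)%:P; rewrite fE cE big_cons -polyCM; congr _%:P; ring.
  exists [::]; split=> //; exists u%:P; first exact: rmorph_unit.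
  by rewrite cE !big_nil !mulr1.
have [[c [a [b [c0 E sa sb]]]]|irr] := classic (exists c a b,
  [/\ c != 0, c%:P * f = a * b, (1 < size a)%N & (1 < size b)%N]).
  have [a' [b' [fE sa' sb']]] := clear_denominator c0 E.
  have : a' * b' != 0 by rewrite -fE.
  rewrite mulf_eq0 negb_or => /andP[a0 b0].
  have szE : size f = (size a + size b).-1 by rewrite fE size_mul // sa' sb'.
  have [|//|ps psP] := IH a'.
    rewrite -ltnS (leq_trans _ ltN) // szE sa' ltnS.
    by case: (size b) sb => [|[|m]] // _; rewrite !addnS /= ltnS leq_addr.
  have [|//|rs rsP] := IH b'.
    rewrite -ltnS (leq_trans _ ltN) // szE sb' ltnS.
    by case: (size a) sa => [|[|m]] // _; rewrite !addSn /= ltnS leq_addl.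
  by exists (ps ++ rs); rewrite fE; apply: factoredM.
exists [:: f]; apply: factored_prime; apply: primitive_prime => // c a b c0 E sa.
by rewrite leqNgt; apply/negP=> sb; apply: irr; exists c, a, b.
Qed.

End Gauss.

Lemma prime_elt_iso (A B : idomainType) (f : {rmorphism A -> B}) (g : {rmorphism B -> A}) :
  cancel f g -> cancel g f -> forall p, prime_elt p -> prime_elt (f p).
Proof.
move=> fK gK p [p0 pU pM]; split.
- by apply: contra_neq p0 => fp0; rewrite -(fK p) fp0 rmorph0.
- by apply: contra pU => Ufp; rewrite -(fK p) rmorph_unit.
move=> a b [c cE]; have : rdvd p (g a * g b).
  by exists (g c); rewrite -rmorphM cE rmorphM fK.
by case/pM=> -[d dE]; [left|right]; exists (f d); rewrite -rmorphM -dE gK.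
Qed.

Lemma ufd_iso (A B : idomainType) (f : {rmorphism A -> B}) (g : {rmorphism B -> A}) :
  cancel f g -> cancel g f -> is_ufd A -> is_ufd B.
Proof.
move=> fK gK factA b b0; have [|ps [psP [u Uu gbE]]] := factA (g b).
  by apply: contra_neq b0 => gb0; rewrite -(gK b) gb0 rmorph0.
exists (map f ps); split=> [_ /mapP[p pin ->]|].
  exact: prime_elt_iso fK gK _ (psP p pin).
exists (f u); first exact: rmorph_unit.
by rewrite big_map -(gK b) gbE rmorphM rmorph_prod.
Qed.

(** * Multivariate polynomials as univariate ones *)

Lemma mpoly_ring_ind (n : nat) (R : nzRingType) (P : {mpoly R[n]} -> Prop) :
  (forall c, P c%:MP) -> (forall i, P 'X_i) ->
  (forall p q, P p -> P q -> P (p + q)) -> (forall p q, P p -> P q -> P (p * q)) ->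
  forall p, P p.
Proof.
move=> PC PX PD PM p; rewrite (mpolyE p).
elim/big_rec: _ => [|m q _ Pq]; first exact: (PC 0).
apply: (PD _ _ _ Pq); rewrite -mul_mpolyC; apply: (PM) => //.
rewrite mpolyXE_id; elim/big_rec: _ => [|i r _ Pr]; first exact: (PC 1).
apply: (PM _ _ _ Pr); elim: (m i) => [|k IH]; first exact: (PC 1).
by rewrite exprS; apply: PM.
Qed.

Section MultiUni.

Variables (n : nat) (R : idomainType).

Lemma widen_lift_max (i : 'I_n) : widen_ord (leqnSn n) i = lift ord_max i :> 'I_n.+1.
Proof. by apply: val_inj; rewrite /= /bump leqNgt ltn_ord. Qed.

Lemma muniXmax : muni ('X_ord_max : {mpoly R[n.+1]}) = 'X.
Proof.
rewrite muniE msuppX big_seq1 mcoeffX eqxx mnmE eqxx expr1.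
rewrite (_ : [multinom _ | i < n] = 0%MM) ?mpolyX0 ?scale1r //.
by apply/mnmP=> i; rewrite !mnmE widen_lift_max (negPf (neq_lift _ _)).
Qed.

Lemma muniXlift (i : 'I_n) :
  muni ('X_(lift ord_max i) : {mpoly R[n.+1]}) = ('X_i)%:P.
Proof.
rewrite muniE msuppX big_seq1 mcoeffX eqxx mnmE eq_sym (negPf (neq_lift _ _)).
rewrite scale1r expr0 alg_polyC; congr ('X_[_])%:P.
by apply/mnmP=> j; rewrite !mnmE widen_lift_max (inj_eq (@lift_inj _ _)).
Qed.

(** The inverse of [muni], which isolates the last variable. *)
Definition unim (p : {poly {mpoly R[n]}}) : {mpoly R[n.+1]} :=
  (map_poly (@mwiden n R) p).['X_ord_max].

Lemma unim_is_zmod_morphism : zmod_morphism unim.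
Proof. by move=> p q; rewrite /unim rmorphB hornerD hornerN. Qed.

Lemma unim_is_monoid_morphism : monoid_morphism unim.
Proof. by split=> [|p q]; rewrite /unim ?rmorph1 ?hornerC // rmorphM hornerM. Qed.

HB.instance Definition _ :=
  GRing.isZmodMorphism.Build {poly {mpoly R[n]}} {mpoly R[n.+1]} unim
    unim_is_zmod_morphism.
HB.instance Definition _ :=
  GRing.isMonoidMorphism.Build {poly {mpoly R[n]}} {mpoly R[n.+1]} unim
    unim_is_monoid_morphism.

Lemma unimD : {morph unim : p q / p + q}.
Proof. by move=> p q; rewrite /unim rmorphD hornerD. Qed.

Lemma unimM : {morph unim : p q / p * q}.
Proof. by move=> p q; rewrite /unim rmorphM hornerM. Qed.

Lemma unimC (p : {mpoly R[n]}) : unim p%:P = mwiden p.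
Proof. by rewrite /unim map_polyC hornerC. Qed.

Lemma unimX : unim 'X = 'X_ord_max.
Proof. by rewrite /unim map_polyX hornerX. Qed.

Lemma muni_mwiden (p : {mpoly R[n]}) : muni (mwiden p) = p%:P.
Proof.
elim/mpoly_ring_ind: p => [c|i|p q IHp IHq|p q IHp IHq].
- by rewrite mwidenC muniC.
- by rewrite mwidenX mnmwiden1 widen_lift_max muniXlift.
- by rewrite mwidenD muniD IHp IHq polyCD.
- by rewrite mwidenM muniM IHp IHq polyCM.
Qed.

Lemma muniK : cancel (@muni n R) unim.
Proof.
suff H (p : {mpoly R[n.+1]}) : unim (muni p) = p by exact: H.
elim/mpoly_ring_ind: p => [c|i|p q IHp IHq|p q IHp IHq].
- by rewrite muniC unimC mwidenC.
- case: (unliftP ord_max i) => [j ->|->]; last by rewrite muniXmax unimX.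
  by rewrite muniXlift unimC mwidenX mnmwiden1 widen_lift_max.
- by rewrite muniD unimD; exact: (congr2 _ IHp IHq).
- by rewrite muniM unimM; exact: (congr2 _ IHp IHq).
Qed.

Lemma unimK : cancel unim (@muni n R).
Proof.
elim/poly_ind=> [|p c IH]; first by rewrite /unim map_poly0 horner0 muni0.
by rewrite unimD unimM unimC unimX muniD muniM IH muniXmax muni_mwiden.
Qed.

Lemma meval_muni (p : {mpoly R[n.+1]}) (w : 'I_n.+1 -> R) :
  p.@[w] = (map_poly (meval (fun i => w (lift ord_max i))) (muni p)).[w ord_max].
Proof.
elim/mpoly_ring_ind: p => [c|i|p q IHp IHq|p q IHp IHq].
- by rewrite muniC map_polyC hornerC /= !mevalC.
- case: (unliftP ord_max i) => [j ->|->].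
    by rewrite muniXlift map_polyC hornerC /= !mevalXU.
  by rewrite muniXmax map_polyX hornerX mevalXU.
- by rewrite muniD mevalD rmorphD hornerD IHp IHq.
- by rewrite muniM mevalM rmorphM hornerM IHp IHq.
Qed.

Lemma muni_mderiv_max (p : {mpoly R[n.+1]}) : muni p^`M(ord_max) = (muni p)^`().
Proof.
elim/mpoly_ring_ind: p => [c|i|p q IHp IHq|p q IHp IHq].
- by rewrite mderivC muniC derivC muni0.
- rewrite mderivX mnmE; case: (unliftP ord_max i) => [j ->|->].
    by rewrite muniXlift derivC eq_sym (negPf (neq_lift _ _)) scale0r muni0.
  rewrite muniXmax derivX eqxx scale1r -muni1 -mpolyX0; congr (muni 'X_[_]).
  by apply/mnmP=> j; rewrite !mnmE subnn.
- by rewrite mderivD !muniD derivD IHp IHq.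
- by rewrite mderivM muniD !muniM derivM IHp IHq.
Qed.

End MultiUni.

Theorem ufd_mpoly (K : fieldType) (n : nat) : is_ufd {mpoly K[n]}.
Proof.
elim: n => [|n IH].
  move=> a a0; exists [::]; split=> //; exists a; rewrite ?big_nil ?mulr1 //.
  rewrite (nvar0_mpolyC a); apply: rmorph_unit; rewrite unitfE.
  by apply: contra_neq a0 => a0; rewrite (nvar0_mpolyC a) a0 mpolyC0.
exact: ufd_iso (@unimK n K) (@muniK n K) (ufd_poly IH).
Qed.

(** A prime factor of [F] exists because [F] is not constant, and irreducibility forces its cofactor
    to be a unit. *)
Lemma irreducible_mpoly_prime (n : nat) (F : {mpoly CC[n]}) :
  irreducible_mpoly F -> prime_elt F.
Proof.
case=> sF irr; have F0 : F != 0 by apply: contraTneq sF => ->; rewrite msize0.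
have const_unit (p : {mpoly CC[n]}) : p != 0 -> (msize p <= 1)%N -> p \is a GRing.unit.
  move=> p0 /msize1_polyC pE; move: p0; rewrite pE mpolyC_eq0 => c0.
  by apply: rmorph_unit; rewrite unitfE.
have unit_const (p : {mpoly CC[n]}) : p \is a GRing.unit -> (msize p <= 1)%N.
  by case/andP=> /eqP -> _; rewrite msizeC leq_b1.
have [[|p ps] [psP [u Uu FE]]] := ufd_mpoly F0.
  by move: sF; rewrite FE big_nil mulr1 ltnNge unit_const.
have pP := psP p (mem_head _ _); have [p0 pU _] := pP.
move: FE; rewrite big_cons mulrCA mulrC => FE.
have v0 : u * \prod_(j <- ps) j != 0 by apply: contra_neq F0 => v0; rewrite FE v0 mul0r.
rewrite FE; apply: prime_elt_unitM pP; apply: (const_unit) => //.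
by case: (irr _ _ FE) => // /(const_unit _ p0); rewrite (negPf pU).
Qed.

(** If the gcd [g] of [f] and its derivative is constant, Bezout gives [h]. Otherwise a multiple of
    [f] is [q * g] with [q] shorter than [f], so the prime [f] divides [g] and thus a nonzero
    constant times the derivative, which is too short. *)
Lemma prime_coprime_deriv (D : idomainType) (f : {poly D}) :
  prime_elt f -> f^`() != 0 ->
  exists h a b, h != 0 /\ h%:P = a * f + b * f^`().
Proof.
move=> [f0 _ fP] f'0; have rdvd_size a : rdvd f a -> a != 0 -> (size f <= size a)%N.
  case=> c ->; rewrite mulf_eq0 negb_or => /andP[_ c0].
  by rewrite size_mul // -subn1 -addnBA ?leq_addr ?size_poly_gt0.
set g := gcdp f f^`(); have g0 : g != 0 by rewrite gcdp_eq0 negb_and f0.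
have [sg|sg] := leqP (size g) 1.
  have [[u v] /= /eqpP[[k l] /= /andP[k0 l0] E]] := Bezoutp f f^`().
  have gE : gcdp f f^`() = (g`_0)%:P by apply: size1_polyC.
  exists (l * g`_0), (k%:P * u), (k%:P * v); split.
    by rewrite mulf_neq0 // -(polyC_eq0 g`_0) -gE.
  by rewrite polyCM -gE mul_polyC -E -mul_polyC mulrDr !mulrA.
have [[c q] /= c0 qE] := Pdiv.Idomain.dvdpP _ _ (dvdp_gcdl f f^`()).
have [[e r] /= e0 rE] := Pdiv.Idomain.dvdpP _ _ (dvdp_gcdr f f^`()).
have : rdvd f (q * g) by exists c%:P; rewrite -qE -mul_polyC mulrC.
have q0 : q != 0.
  by apply/eqP=> q0; move/eqP: qE; rewrite q0 mul0r scale_poly_eq0 (negPf c0) (negPf f0).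
case/fP=> [/rdvd_size/(_ q0)|[t tE]].
  rewrite -(size_scale f c0) qE size_mul // leqNgt.
  by case: (size g) sg => [|[|m]] // _; rewrite !addnS /= ltnS leq_addr.
have : rdvd f (e *: f^`()) by exists (r * t); rewrite rE -/g tE mulrCA.
move/rdvd_size; rewrite scale_poly_eq0 negb_or e0 f'0 size_scale // => /(_ isT).
by rewrite leqNgt lt_size_deriv.
Qed.

(** * Extension of derivations *)

Definition prime_ideal (R : comNzRingType) (P : R -> Prop) : Prop :=
  [/\ P 0, ~ P 1, (forall a b, P a -> P b -> P (a + b)), (forall a b, P b -> P (a * b)) &
      forall a b, P (a * b) -> P a \/ P b].

Definition subring (R : comNzRingType) (B : R -> Prop) : Prop :=
  [/\ B 1, (forall a b, B a -> B b -> B (a - b)) & forall a b, B a -> B b -> B (a * b)].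

Definition derivation (R : comNzRingType) (d : R -> R) : Prop :=
  (forall a b, d (a + b) = d a + d b) /\ (forall a b, d (a * b) = d a * b + a * d b).

Section Derivations.

Variable R : comNzRingType.
Implicit Types (P B : R -> Prop) (d e : R -> R) (q : {poly R}).

Lemma prime_ideal_sum P (I : Type) (r : seq I) (F : I -> R) :
  prime_ideal P -> (forall i, P (F i)) -> P (\sum_(i <- r) F i).
Proof. by case=> P0 _ PD _ _ PF; elim/big_rec: _ => // i x _; apply: PD. Qed.

Lemma prime_idealB P a b : prime_ideal P -> P a -> P b -> P (a - b).
Proof. by case=> _ _ PD PM _ Pa Pb; apply: PD => //; rewrite -mulN1r; apply: PM. Qed.

Lemma prime_idealX P a k : prime_ideal P -> ~ P a -> ~ P (a ^+ k).
Proof.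
case=> _ P1 _ _ Pp Pa; elim: k => [|k IH]; first by rewrite expr0.
by rewrite exprS => /Pp[].
Qed.

Lemma subring0 B : subring B -> B 0.
Proof. by case=> B1 BB _; rewrite -(subrr 1); apply: BB. Qed.

Lemma subringD B a b : subring B -> B a -> B b -> B (a + b).
Proof.
move=> sB; have [_ BB _] := sB => Ba Bb; rewrite -[b]opprK; apply: (BB) => //.
by rewrite -sub0r; apply: (BB) => //; apply: subring0.
Qed.

Lemma subring_sum B (I : Type) (r : seq I) (F : I -> R) :
  subring B -> (forall i, B (F i)) -> B (\sum_(i <- r) F i).
Proof.
move=> sB BF; elim/big_rec: _ => [|i x _]; first exact: subring0.
exact: subringD.
Qed.

Lemma derivation0 d : derivation d -> d 0 = 0.
Proof. by case=> dD _; apply: (addrI (d 0)); rewrite -dD !addr0. Qed.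


Lemma derivation_sum d (I : Type) (r : seq I) (F : I -> R) :
  derivation d -> d (\sum_(i <- r) F i) = \sum_(i <- r) d (F i).
Proof.
move=> dd; elim: r => [|i r IH]; first by rewrite !big_nil derivation0.
by rewrite !big_cons (proj1 dd) IH.
Qed.

Lemma derivation_horner d q y : derivation d -> (forall i, d q`_i = 0) ->
  d q.[y] = q^`().[y] * d y.
Proof.
move=> dd; elim/poly_ind: q => [|q c IH] dq.
  by rewrite deriv0 !horner0 mul0r derivation0.
have dc : d c = 0 by have := dq 0%N; rewrite coefD coefMX coefC add0r.
have {}IH : d q.[y] = q^`().[y] * d y.
  by apply: IH => i; have := dq i.+1; rewrite coefD coefMX coefC addr0.
rewrite derivD derivC addr0 derivM derivX mulr1 !hornerD !hornerM hornerX hornerC.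
by rewrite (proj1 dd) (proj2 dd) dc addr0 IH; ring.
Qed.

Lemma derivation_comb d e s w :
  derivation d -> derivation e -> derivation (fun z => s * d z + w * e z).
Proof.
by move=> [dD dM] [eD eM]; split=> a b; rewrite ?dD ?eD ?dM ?eM; ring.
Qed.

Definition adjoin B y : R -> Prop :=
  fun z => exists q, (forall i, B q`_i) /\ z = q.[y].

Lemma adjoin_sub B y b : subring B -> B b -> adjoin B y b.
Proof.
move=> sB Bb; exists b%:P; split=> [i|]; last by rewrite hornerC.
by rewrite coefC; case: ifP => _ //; apply: subring0.
Qed.

Lemma adjoin_gen B y : subring B -> adjoin B y y.
Proof.
move=> sB; exists 'X; split=> [i|]; last by rewrite hornerX.
by rewrite coefX; case: eqP => _; [case: sB|apply: subring0].
Qed.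

Lemma adjoin_subring B y : subring B -> subring (adjoin B y).
Proof.
move=> sB; have [B1 BB BM] := sB; split; first exact: adjoin_sub.
  move=> a b [p [Bp ->]] [q [Bq ->]]; exists (p - q); split=> [i|].
    by rewrite coefB; apply: BB.
  by rewrite hornerD hornerN.
move=> a b [p [Bp ->]] [q [Bq ->]]; exists (p * q); split=> [i|].
  by rewrite coefM; apply: subring_sum => // j; apply: BM.
by rewrite hornerM.
Qed.

Lemma ex_min_size (Q : {poly R} -> Prop) :
  (exists q, Q q) -> exists2 m, Q m & forall q, Q q -> (size m <= size q)%N.
Proof.
case=> q Qq; have [N] := ubnP (size q); elim: N q Qq => // N IH q Qq ltN.
have [[r [Qr ltr]]|nr] := classic (exists r, Q r /\ (size r < size q)%N).
  by apply: (IH r) => //; apply: leq_trans ltr _.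
exists q => // r Qr; rewrite leqNgt; apply/negP=> ltr; apply: nr.
by exists r.
Qed.

(** Each step cancels the leading term of [a q] against a multiple of [m], using only ring
    operations on coefficients, so the remainder stays over [B]. The quotient [t] is left
    unconstrained: it will only be evaluated. *)
Lemma pseudo_division B (m : {poly R}) : subring B -> (forall i, B m`_i) -> m != 0 ->
  forall q, (forall i, B q`_i) -> exists k (t r : {poly R}),
  [/\ forall i, B r`_i, (size r < size m)%N & (lead_coef m ^+ k)%:P * q = t * m + r].
Proof.
move=> sB Bm m0 q; have [B1 BB BM] := sB.
have [N] := ubnP (size q); elim: N q => // N IH q; rewrite ltnS => leN Bq.
have [lt_qm|le_mq] := ltnP (size q) (size m).
  by exists 0%N, 0, q; split=> //; rewrite expr0 mul0r mul1r add0r.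
set a := lead_coef m; set c := lead_coef q; set j := (size q - size m)%N.
have sm : (0 < size m)%N by rewrite size_poly_gt0.
have coefE i : (c%:P * 'X^j * m)`_i = if (i < j)%N then 0 else c * m`_(i - j).
  by rewrite -mulrA coefCM coefXnM; case: ifP; rewrite ?mulr0.
have [||k [t [r [Br ltr E]]]] := IH (a%:P * q - c%:P * 'X^j * m).
- apply: leq_trans leN; rewrite -[X in (_ < X)%N]prednK ?(leq_trans sm) // ltnS.
  apply/leq_sizeP=> i le_i; rewrite coefB coefE coefCM.
  rewrite ltnNge (leq_trans _ le_i) /=; last first.
    by rewrite /j; case: (size m) sm => // k _; rewrite subnS -!subn1 leq_sub2r ?leq_subr.
  have [->|ne_i] := eqVneq i (size q).-1.
    rewrite (_ : (_ - j)%N = (size m).-1) -?lead_coefE ?[c * _]mulrC ?subrr //.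
    rewrite /j; move: le_mq sm; case: (size m) => // k; case: (size q) => // l.
    by rewrite ltnS subSS /= => lekl _; rewrite subKn.
  have {ne_i} le_i : (size q <= i)%N.
    by rewrite -[size q]prednK ?(leq_trans sm) // ltn_neqAle eq_sym ne_i.
  rewrite !nth_default ?mulr0 ?subrr //.
  by rewrite /j leq_subRL ?subnK // (leq_trans (leq_subr _ _)).
- move=> i; rewrite coefB coefE coefCM; apply: BB; first by apply: BM => //; apply: Bm.
  by case: ifP => _; [apply: subring0|apply: BM => //; apply: Bq].
exists k.+1, (t + (a ^+ k)%:P * (c%:P * 'X^j)), r; split=> //.
rewrite exprSr polyCM -mulrA mulrDl -mulrA addrAC -E; ring.
Qed.

(* If [y] is transcendental over [B] modulo [P] then [s = 1, w = 0] works.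
   Otherwise let [m] be a minimal polynomial of [y]: the choice
   [s = e m(y) = m'(y)], [w = - d m(y)] makes the combination vanish at [m(y)],
   and pseudo-division by [m] handles the other relations. *)
Lemma extend_derivation P B d e y :
  prime_ideal P -> (forall k, ~ P k.+1%:R) -> subring B ->
  derivation d -> derivation e -> (forall b, B b -> e b = 0) -> e y = 1 ->
  (forall b, B b -> P b -> P (d b)) ->
  exists s w, ~ P s /\
    forall z, adjoin B y z -> P z -> P (s * d z + w * e z).
Proof.
move=> pP Pnat sB dd de eB ey dP; have [P0 P1 PD PM Pp] := pP; have [B1 BB BM] := sB.
have PMr a b : P a -> P (a * b) by rewrite mulrC; apply: PM.
have null (D : R -> R) q : derivation D -> (forall b, B b -> P b -> P (D b)) ->
    (forall i, B q`_i) -> (forall i, P q`_i) -> P (D q.[y]).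
  move=> dD DP Bq Pq; rewrite horner_coef derivation_sum //.
  apply: prime_ideal_sum => // i; rewrite (proj2 dD).
  by apply: PD; apply: PMr; [apply: DP|].
(* Algebraic relations for [y] modulo [P] that are not trivial modulo [P]. *)
pose Z q := [/\ forall i, B q`_i, P q.[y] & ~ forall i, P q`_i].
have [/ex_min_size[m [Bm Pm nm] mmin]|nZ] := classic (exists q, Z q); last first.
  exists 1, 0; split=> // z [q [Bq ->]] Pq; rewrite mul0r addr0 mul1r.
  by apply: null => // i; apply: NNPP => nPi; apply: nZ; exists q; split=> // h.
have zmin q : (forall i, B q`_i) -> P q.[y] -> (size q < size m)%N -> forall i, P q`_i.
  move=> Bq Pq ltq; apply: NNPP => nq; have := mmin q; rewrite leqNgt ltq.
  by move=> /(_ (And3 Bq Pq nq)).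
have m0 : m != 0 by apply/eqP=> mE; apply: nm => i; rewrite mE coef0.
have sm : (0 < size m)%N by rewrite size_poly_gt0.
(* Otherwise deleting the leading term would leave a shorter nontrivial relation. *)
set a := lead_coef m; have Pa : ~ P a.
  move=> Pa; apply: nm; pose m1 := m - a%:P * 'X^((size m).-1).
  have m1E i : m1`_i = m`_i - a * (i == (size m).-1)%:R by rewrite coefB coefCM coefXn.
  suff h i : P m1`_i.
    move=> i; rewrite -(subrK (a * (i == (size m).-1)%:R) m`_i) -m1E.
    by apply: PD => //; apply: PMr.
  apply: zmin.
  - move=> k; rewrite m1E; apply: BB => //; apply: BM; first exact: Bm.
    by case: (k == _); [|apply: subring0].
  - rewrite hornerD hornerN hornerM hornerC; apply: prime_idealB => //; exact: PMr.
  - rewrite -[X in (_ < X)%N]prednK // ltnS; apply/leq_sizeP=> k le_k; rewrite m1E.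
    have [->|ne_k] := eqVneq k (size m).-1; first by rewrite mulr1 /a lead_coefE subrr.
    by rewrite mulr0 subr0 nth_default // -[size m]prednK // ltn_neqAle eq_sym ne_k.
(* Otherwise the derivative is a shorter relation, hence trivial, and its top coefficient, a
   positive integer times [a], lies in [P]. If [m] is constant, [a] itself lies in [P]. *)
have Pm' : ~ P m^`().[y].
  move=> Pm'; have /zmin h : forall i, B m^`()`_i.
    move=> i; rewrite coef_deriv -mulr_natr; apply: BM => //.
    by elim: (i.+1) => [|k IH]; [apply: subring0|rewrite -natr1; apply: subringD].
  have := h Pm' (lt_size_deriv m0) (size m).-2; rewrite coef_deriv.
  case sE : (size m) sm => [|[|k]] //= _.
    have mC : m = a%:P by rewrite /a lead_coefE sE; apply: size1_polyC; rewrite sE.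
    by move: Pm; rewrite mC hornerC.
  have -> : m`_k.+1 = a by rewrite /a lead_coefE sE.
  by rewrite -mulr_natr => /Pp[//|/Pnat].
exists m^`().[y], (- d m.[y]); split=> // _ [q [Bq ->]] Pq.
set D := fun z => m^`().[y] * d z + - d m.[y] * e z; rewrite -/(D q.[y]).
have dD : derivation D by apply: derivation_comb.
have eE (p : {poly R}) : (forall i, B p`_i) -> e p.[y] = p^`().[y].
  by move=> Bp; rewrite derivation_horner // ?ey ?mulr1 // => i; apply: eB.
have Dm : D m.[y] = 0 by rewrite /D eE // mulNr mulrC subrr.
have [k [t [r [Br ltr E]]]] := pseudo_division sB Bm m0 Bq.
have Ey : lead_coef m ^+ k * q.[y] = t.[y] * m.[y] + r.[y].
  by rewrite -hornerM -hornerD -E hornerM hornerC.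
have Pr : P r.[y].
  rewrite (_ : r.[y] = lead_coef m ^+ k * q.[y] - t.[y] * m.[y]); last by rewrite Ey addrC addKr.
  by apply: prime_idealB; last exact: PM; first by []; apply: PM.
have PDr : P (D r.[y]).
  apply: null => // [b Bb Pb|]; last exact: zmin.
  by rewrite /D eB // mulr0 addr0; apply: PM; apply: dP.
(* By the Leibniz rule this is the power of [a] times [D q.[y]]; primality then cancels the
   power. *)
have : P (D (lead_coef m ^+ k * q.[y]) - D (lead_coef m ^+ k) * q.[y]).
  apply: prime_idealB => //; last exact: PM.
  rewrite Ey (proj1 dD) (proj2 dD) Dm mulr0 addr0.
  by apply: PD => //; apply: PM.
rewrite (proj2 dD) addrC addKr => /Pp[|//].
by move=> Pak; case: (prime_idealX pP Pa Pak).
Qed.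

End Derivations.

(** * The incidence set and its vanishing ideal *)

Lemma poly_nonroot (K : numDomainType) (f : {poly K}) : f != 0 -> exists t, f.[t] != 0.
Proof.
move=> f0; apply: NNPP => nr.
have := @max_poly_roots K f [seq i%:R | i <- iota 0 (size f)] f0.
rewrite size_map size_iota ltnn => absurd; suff : false by [].
apply: absurd; last first.
  by rewrite map_inj_uniq ?iota_uniq // => i j /eqP; rewrite eqr_nat => /eqP.
by apply/allP=> t _; apply/negPn/negP => ft; apply: nr; exists t.
Qed.

Lemma mpoly_nonroot (K : numDomainType) (n : nat) (p : {mpoly K[n]}) :
  p != 0 -> exists v, p.@[v] != 0.
Proof.
elim: n p => [|n IH] p p0.
  exists (fun=> 0); move: p0; rewrite (nvar0_mpolyC p) mevalC.
  by rewrite mpolyC_eq0.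
have f0 : muni p != 0.
  by apply: contra_neq p0 => f0; rewrite -(muniK p) f0 /unim map_poly0 horner0.
have [v lv] := IH (lead_coef (muni p)) (etrans (congr1 negb (lead_coef_eq0 _)) f0).
have [|t ft] := @poly_nonroot K (map_poly (meval v) (muni p)).
  by rewrite -lead_coef_eq0 lead_coef_map_eq // -lead_coef_eq0.
exists (fun i => if unlift ord_max i is Some j then v j else t).
rewrite meval_muni unlift_none; apply: contra_neq ft => <-.
congr (_.[_]); apply: eq_map_poly => c; apply: meval_eq => i.
by rewrite liftK.
Qed.

(** Constant matrices [A] and [B] reduce [J] at [x] to the identity of size its rank. The
    determinant of [A J B] then plays the part of a maximal minor. *)
Lemma rank_semicontinuous (K : fieldType) (m k l : nat) (J : 'M[{mpoly K[m]}]_(k, l))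
    (x : 'I_m -> K) :
  exists M : {mpoly K[m]}, M.@[x] != 0 /\
    forall y, M.@[y] != 0 ->
      (\rank (map_mx (meval x) J) <= \rank (map_mx (meval y) J))%N.
Proof.
set Jx := map_mx (meval x) J; set r := \rank Jx.
pose A : 'M[K]_(r, k) := pid_mx r *m invmx (col_ebase Jx).
pose B : 'M[K]_(l, r) := invmx (row_ebase Jx) *m pid_mx r.
have AJB : A *m Jx *m B = 1%:M.
  rewrite -{1}(mulmx_ebase Jx) /A /B !mulmxA mulmxKV ?col_ebase_unit //.
  rewrite mulmxK ?row_ebase_unit // -/r !pid_mx_id ?pid_mx_1 ?rank_leq_row ?rank_leq_col //.
clearbody A B.
pose M := \det (map_mx (@mpolyC m K) A *m J *m map_mx (@mpolyC m K) B).
have ME y : M.@[y] = \det (A *m map_mx (meval y) J *m B).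
  rewrite /M -det_map_mx !map_mxM /=; congr (\det (_ *m _ *m _)).
    by apply/matrixP=> i j; rewrite 2!mxE mevalC.
  by apply/matrixP=> i j; rewrite 2!mxE mevalC.
exists M; split=> [|y]; first by rewrite ME AJB det1 oner_eq0.
rewrite ME => dn0; set Jy := map_mx _ _.
have : A *m Jy *m B \in unitmx by rewrite unitmxE unitfE.
move/mxrank_unit => <-.
exact: leq_trans (mxrankM_maxl _ _) (mxrankM_maxr _ _).
Qed.

(** [X] is the union of its closed subsets [p = 0] and [q = 0], so it equals one of them. *)
Lemma irreducible_variety_prime (m : nat) (X : ('I_m -> CC) -> Prop) (p q : {mpoly CC[m]}) :
  irreducible_variety X -> vanishes_on X (p * q) -> vanishes_on X p \/ vanishes_on X q.
Proof.
case=> cX _ irr pq; have cl (f : {mpoly CC[m]}) : zclosed (fun x => X x /\ f.@[x] = 0).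
  move=> v clv; split; last by apply: clv => a [].
  by apply: cX => g gX; apply: clv => a [/gX].
case: (irr _ _ (cl p) (cl q)) => [x|h|h]; last 2 first.
- by left=> x /h[].
- by right=> x /h[].
split=> [Xx|[[]|[]] //]; have /eqP := pq x Xx.
by rewrite mevalM mulf_eq0 => /orP[] /eqP; [left|right].
Qed.

Lemma irreducible_variety_meet (m : nat) (X : ('I_m -> CC) -> Prop) (p q : {mpoly CC[m]}) x y :
  irreducible_variety X -> X x -> X y -> p.@[x] != 0 -> q.@[y] != 0 ->
  exists2 z, X z & (p * q).@[z] != 0.
Proof.
move=> irr Xx Xy px qy; apply: NNPP => nz.
have /(irreducible_variety_prime irr)[h|h] : vanishes_on X (p * q).
- by move=> z Xz; apply/eqP/negPn/negP => pqz; apply: nz; exists z.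
- by rewrite h ?eqxx in px.
- by rewrite h ?eqxx in qy.
Qed.

Lemma ex_max_nat (Q : nat -> Prop) (b : nat) :
  (exists k, Q k) -> (forall k, Q k -> (k <= b)%N) ->
  exists2 k, Q k & forall l, Q l -> (l <= k)%N.
Proof.
move=> [k Qk] bQ; have [N] := ubnP (b - k); elim: N k Qk => // N IH k Qk ltN.
have [[l [Ql ltl]]|nl] := classic (exists l, Q l /\ (k < l)%N).
  apply: (IH l Ql); rewrite ltnS in ltN; apply: leq_trans ltN.
  by apply: ltn_sub2l => //; apply: leq_trans ltl (bQ _ Ql).
by exists k => // l Ql; rewrite leqNgt; apply/negP=> ltl; apply: nl; exists l.
Qed.

Lemma jacobianE (m k : nat) (ps : 'I_k -> {mpoly CC[m]}) x :
  jacobian ps x = map_mx (meval x) (\matrix_(i < k, j < m) (ps i)^`M(j)).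
Proof. by apply/matrixP=> i j; rewrite !mxE. Qed.

(** Ranks are bounded by [m], so a single finite system attains the largest Jacobian rank at [x].
    Semicontinuity keeps that rank wherever [M] is nonzero, and regularity of [x] makes it maximal
    over [X]. *)
Lemma regular_point_open (m : nat) (X : ('I_m -> CC) -> Prop) x :
  regular_point X x -> exists M : {mpoly CC[m]}, M.@[x] != 0 /\
    forall y, X y -> M.@[y] != 0 -> regular_point X y.
Proof.
case=> Xx reg.
pose Q r := exists k (ps : 'I_k -> {mpoly CC[m]}),
  (forall i, vanishes_on X (ps i)) /\ r = \rank (jacobian ps x).
have [||_ [k [ps [psX ->]]] rmax] := @ex_max_nat Q m.
- by exists (\rank (jacobian (fun _ : 'I_0 => 0) x)), 0%N, (fun=> 0); split=> // -[].
- by move=> _ [k [ps [_ ->]]]; apply: rank_leq_col.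
have [M [Mx MP]] := rank_semicontinuous (\matrix_(i < k, j < m) (ps i)^`M(j)) x.
exists M; split=> // y Xy My; split=> // z Xz k1 ps1 ps1X.
have [k2 [ps2 [ps2X le2]]] := reg z Xz k1 ps1 ps1X.
exists k, ps; split=> //; apply: leq_trans le2 _.
apply: leq_trans (rmax _ _) _; first by exists k2, ps2.
by rewrite !jacobianE; apply: MP.
Qed.

(** * Primality of the ideal of the incidence set *)

Section Correspondence.

Variable n : nat.
Implicit Types (X : ('I_n -> CC) -> Prop) (x u w : 'I_n -> CC).

Lemma pairptl x u j : pairpt x u (lshift n j) = x j.
Proof. by rewrite /pairpt (unsplitK (inl j)). Qed.

Lemma pairptr x u j : pairpt x u (rshift n j) = u j.
Proof. by rewrite /pairpt (unsplitK (inr j)). Qed.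

(** The set whose Zariski closure is [ED_corr X]; both have the same vanishing ideal. *)
Definition ED_incidence X : ('I_(n + n) -> CC) -> Prop := fun v =>
  regular_point X (fun j => v (lshift n j)) /\
  in_normal_space X (fun j => v (lshift n j))
    (fun j => v (rshift n j) - v (lshift n j)).

Lemma ED_incidence_pairpt X x u :
  ED_incidence X (pairpt x u) <->
  regular_point X x /\ in_normal_space X x (fun j => u j - x j).
Proof.
rewrite /ED_incidence.
have -> : (fun j => pairpt x u (lshift n j)) = x.
  by apply: functional_extensionality => j; rewrite pairptl.
suff -> : (fun j => pairpt x u (rshift n j) - pairpt x u (lshift n j)) =
          (fun j => u j - x j) by [].
by apply: functional_extensionality => j; rewrite pairptl pairptr.
Qed.

Lemma pairpt_surj (v : 'I_(n + n) -> CC) :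
  v = pairpt (fun j => v (lshift n j)) (fun j => v (rshift n j)).
Proof.
apply: functional_extensionality => i; rewrite -(splitK i).
by case: (split i) => j /=; rewrite ?pairptl ?pairptr.
Qed.

Lemma ED_incidence_corr X v : ED_incidence X v -> ED_corr X v.
Proof. by move=> Ev p; apply. Qed.

Lemma in_normal_space_comb X x w1 w2 (a b : CC) :
  in_normal_space X x w1 -> in_normal_space X x w2 ->
  in_normal_space X x (fun j => a * w1 j + b * w2 j).
Proof.
move=> [k1 [ps1 [c1 [V1 E1]]]] [k2 [ps2 [c2 [V2 E2]]]].
exists (k1 + k2)%N, (fun i => match split i with inl j => ps1 j | inr j => ps2 j end).
exists (fun i => match split i with inl j => a * c1 j | inr j => b * c2 j end).
split=> [i|j]; first by case: (split i).
rewrite big_split_ord /= E1 E2 !mulr_sumr; congr (_ + _); apply: eq_bigr => i _.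
  by rewrite (unsplitK (inl i)) mulrA.
by rewrite (unsplitK (inr i)) mulrA.
Qed.

Lemma mmap_horner (k : nat) (h : 'I_k -> {poly CC}) (p : {mpoly CC[k]}) t :
  (mmap polyC h p).[t] = p.@[fun i => (h i).[t]].
Proof.
elim/mpoly_ring_ind: p => [c|i|p q IHp IHq|p q IHp IHq].
- by rewrite mmapC hornerC mevalC.
- by rewrite mmapX mmap1U mevalXU.
- by rewrite mmapD hornerD mevalD IHp IHq.
- by rewrite rmorphM hornerM mevalM IHp IHq.
Qed.

(* Two points of the incidence set lie in a common family: translate [x] by
   [(1 - t) V1 + t V2], where [V1], [V2] extend the two normal vectors to
   polynomial normal fields along [X]. For generic [t] both polynomials stay
   nonzero somewhere on this family, which is parametrized by an open part of [X]. *)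
Lemma ED_incidence_prime X :
  irreducible_variety X -> (exists v, ED_incidence X v) ->
  prime_ideal (vanishes_on (ED_incidence X)).
Proof.
move=> irr [v0 Ev0]; split.
- by move=> v _; rewrite meval0.
- by move/(_ v0 Ev0)/eqP; rewrite meval1 oner_eq0.
- by move=> p q Vp Vq v Ev; rewrite mevalD Vp // Vq // addr0.
- by move=> p q Vq v Ev; rewrite mevalM Vq // mulr0.
move=> p q Vpq; apply: NNPP => /not_or_and[Np Nq].
have wit (r : {mpoly CC[n + n]}) : ~ vanishes_on (ED_incidence X) r ->
    exists x u, [/\ regular_point X x, in_normal_space X x (fun j => u j - x j) &
      r.@[pairpt x u] != 0].
  move=> Nr; apply: NNPP => nw; apply: Nr => v Ev; apply/eqP/negPn/negP => rv.
  apply: nw; exists (fun j => v (lshift n j)), (fun j => v (rshift n j)).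
  by rewrite -pairpt_surj; case: Ev.
have [x1 [u1 [reg1 [k1 [ps1 [c1 [V1 E1]]]] p1]]] := wit p Np.
have [x2 [u2 [reg2 [k2 [ps2 [c2 [V2 E2]]]] q2]]] := wit q Nq.
pose W1 j : {mpoly CC[n]} := \sum_(i < k1) c1 i *: (ps1 i)^`M(j).
pose W2 j : {mpoly CC[n]} := \sum_(i < k2) c2 i *: (ps2 i)^`M(j).
have W1E x j : (W1 j).@[x] = \sum_(i < k1) c1 i * ((ps1 i)^`M(j)).@[x].
  by rewrite raddf_sum; apply: eq_bigr => i _ /=; rewrite mevalZ.
have W2E x j : (W2 j).@[x] = \sum_(i < k2) c2 i * ((ps2 i)^`M(j)).@[x].
  by rewrite raddf_sum; apply: eq_bigr => i _ /=; rewrite mevalZ.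
pose U t x : 'I_n -> CC := fun j => x j + ((1 - t) * (W1 j).@[x] + t * (W2 j).@[x]).
pose line x : 'I_(n + n) -> {poly CC} := fun i => match split i with
  | inl j => (x j)%:P
  | inr j => (x j)%:P + ((1 - 'X) * ((W1 j).@[x])%:P + 'X * ((W2 j).@[x])%:P) end.
have lineE x t r : (mmap polyC (line x) r).[t] = r.@[pairpt x (U t x)].
  rewrite mmap_horner; apply: meval_eq => i; rewrite /line /pairpt.
  case: (split i) => j /=; first by rewrite hornerC.
  by rewrite !(hornerD, hornerN, hornerM, hornerC, hornerX).
(* The parameter 0 recovers [(x1, u1)]; the parameter 1 recovers [(x2, u2)] below. *)
have f0 : mmap polyC (line x1) p != 0.
  apply: contra_neq p1 => f0; have := lineE x1 0 p; rewrite f0 horner0 => ->.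
  apply: meval_eq => i; rewrite /pairpt; case: (split i) => // j.
  by rewrite /U subr0 mul1r mul0r addr0 W1E -E1 addrC subrK.
have g0 : mmap polyC (line x2) q != 0.
  apply: contra_neq q2 => g0; have := lineE x2 1 q; rewrite g0 horner0 => ->.
  apply: meval_eq => i; rewrite /pairpt; case: (split i) => // j.
  by rewrite /U subrr mul1r mul0r add0r W2E -E2 addrC subrK.
have [t ptqt] := poly_nonroot (mulf_neq0 f0 g0).
have [pt qt] : p.@[pairpt x1 (U t x1)] != 0 /\ q.@[pairpt x2 (U t x2)] != 0.
  split; apply: contra_neq ptqt => e0; apply/eqP; rewrite hornerM mulf_eq0; apply/orP.
    by left; apply/eqP; apply: etrans (lineE x1 t p) e0.
  by right; apply/eqP; apply: etrans (lineE x2 t q) e0.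
(* With [t] fixed, [T] maps [x] to [(x, U t x)], so [p] and [q] pull back to polynomials in [x]
   alone. *)
pose T : (n + n).-tuple {mpoly CC[n]} := [tuple match split i with
  | inl j => 'X_j
  | inr j => 'X_j + ((1 - t) *: W1 j + t *: W2 j) end | i < n + n].
have TE x r : (r \mPo T).@[x] = r.@[pairpt x (U t x)].
  rewrite comp_mpoly_meval; apply: meval_eq => i; rewrite tnth_mktuple /pairpt.
  by case: (split i) => j; rewrite ?mevalD ?mevalZ mevalXU.
have [M [M1 Mreg]] := regular_point_open reg1.
have [Xx1 Xx2] : X x1 /\ X x2 by case: reg1 reg2 => ? _ [].
(* Nonempty open subsets of [X] meet: some point of [X] is regular, thanks to [M], with both
   pullbacks nonzero. *)
have [x3 Xx3 p3] := irreducible_variety_meet (p := M) (q := p \mPo T) irr Xx1 Xx1 M1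
  (etrans (congr1 (fun z => z != 0) (TE _ _)) pt).
have [x Xx] := irreducible_variety_meet irr Xx3 Xx2 p3
  (etrans (congr1 (fun z => z != 0) (TE _ _)) qt).
have -> : (M * (p \mPo T) * (q \mPo T)).@[x] =
    M.@[x] * (p.@[pairpt x (U t x)] * q.@[pairpt x (U t x)]).
  by rewrite mevalM mevalM -mulrA; congr (_ * (_ * _)); apply: TE.
rewrite mulf_eq0 negb_or => /andP[/(Mreg x Xx) regx].
rewrite -mevalM Vpq ?eqxx //; apply/ED_incidence_pairpt; split=> //.
have -> : (fun j => U t x j - x j) = (fun j => (1 - t) * (W1 j).@[x] + t * (W2 j).@[x]).
  by apply: functional_extensionality => j; rewrite /U addrC addKr.
apply: in_normal_space_comb; [exists k1, ps1, c1|exists k2, ps2, c2]; by split.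
Qed.

End Correspondence.

(** * The gradient of the squared distance *)

Section Substitution.

Variables (K : comNzRingType) (k l : nat).
Implicit Types (h : 'I_l -> {mpoly K[k]}) (p q : {mpoly K[l]}).

Definition msubst h p : {mpoly K[k]} := p \mPo [tuple h i | i < l].

Lemma msubstC h c : msubst h c%:MP = c%:MP.
Proof. exact: comp_mpolyC. Qed.

Lemma msubstX h i : msubst h 'X_i = h i.
Proof. by rewrite /msubst comp_mpolyXU -tnth_nth tnth_mktuple. Qed.

Lemma msubstD h p q : msubst h (p + q) = msubst h p + msubst h q.
Proof. exact: comp_mpolyD. Qed.

Lemma msubstB h p q : msubst h (p - q) = msubst h p - msubst h q.
Proof. exact: comp_mpolyB. Qed.

Lemma msubstM h p q : msubst h (p * q) = msubst h p * msubst h q.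
Proof. exact: rmorphM. Qed.

Lemma meval_msubst h p v : (msubst h p).@[v] = p.@[fun i => (h i).@[v]].
Proof. by rewrite comp_mpoly_meval; apply: meval_eq => i; rewrite tnth_mktuple. Qed.

Lemma derivation_msubst (d : {mpoly K[k]} -> {mpoly K[k]}) h p :
  derivation d -> (forall c, d c%:MP = 0) ->
  d (msubst h p) = \sum_(i < l) msubst h p^`M(i) * d (h i).
Proof.
move=> [dD dM] dC; elim/mpoly_ring_ind: p => [c|i|p q IHp IHq|p q IHp IHq].
- by rewrite msubstC dC big1 // => i _; rewrite mderivC (msubstC _ 0) mpolyC0 mul0r.
- rewrite msubstX (bigD1 i) //= mderivX mnmE eqxx scale1r.
  have -> : (U_(i) - U_(i))%MM = 0%MM by apply/mnmP=> j; rewrite !mnmE subnn.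
  rewrite mpolyX0 (msubstC _ 1) mpolyC1 mul1r big1 ?addr0 // => j /negPf ne_ji.
  by rewrite mderivX mnmE eq_sym ne_ji scale0r (msubstC _ 0) mpolyC0 mul0r.
- rewrite msubstD dD IHp IHq -big_split /=; apply: eq_bigr => i _.
  by rewrite mderivD msubstD mulrDl.
- rewrite msubstM dM IHp IHq mulr_suml mulr_sumr -big_split /=; apply: eq_bigr => i _.
  by rewrite mderivM msubstD !msubstM; ring.
Qed.

End Substitution.

Section VectorFields.

Variables (K : comNzRingType) (k : nat).
Implicit Types b : 'I_k -> {mpoly K[k]}.

Definition vecfield b (z : {mpoly K[k]}) : {mpoly K[k]} := \sum_(i < k) b i * z^`M(i).

Lemma mderiv_derivation i : derivation (fun z : {mpoly K[k]} => z^`M(i)).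
Proof. by split=> p q; [exact: mderivD|exact: mderivM]. Qed.

Lemma vecfield_derivation b : derivation (vecfield b).
Proof.
split=> p q; rewrite /vecfield.
  by rewrite -big_split /=; apply: eq_bigr => i _; rewrite mderivD mulrDr.
rewrite mulr_suml mulr_sumr -big_split /=; apply: eq_bigr => i _.
by rewrite mderivM; ring.
Qed.

Lemma vecfieldC b c : vecfield b c%:MP = 0.
Proof. by rewrite /vecfield big1 // => i _; rewrite mderivC mulr0. Qed.

Lemma mderivXU i j : ('X_i : {mpoly K[k]})^`M(j) = (i == j)%:R.
Proof.
rewrite mderivX mnmE; case: eqP => [->|_]; last by rewrite scale0r.
have -> : (U_(j) - U_(j))%MM = 0%MM by apply/mnmP=> l; rewrite !mnmE subnn.
by rewrite mpolyX0 scale1r.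
Qed.

Lemma vecfieldX b i : vecfield b 'X_i = b i.
Proof.
rewrite /vecfield (bigD1 i) //= mderivXU eqxx mulr1 big1 ?addr0 // => j /negPf ne_ji.
by rewrite mderivXU eq_sym ne_ji mulr0.
Qed.

End VectorFields.

(** * Vector fields preserving the ideal of the incidence set *)

Section Tangent.

Variables (n : nat) (X : ('I_n -> CC) -> Prop) (d : nat).
Hypotheses (HX : irreducible_variety X) (Hd : EDdeg_is X d) (Hdpos : (0 < d)%N).

Local Notation R := {mpoly CC[n + n]}.
Local Notation I := (vanishes_on (ED_incidence X)).

(** As [d > 0], fibers over generic [u] are nonempty; [u] is chosen off the zeros of both [p] and
    the exceptional hypersurface [g]. *)
Lemma ED_corr_dominant (p : {mpoly CC[n]}) : p != 0 ->
  exists u x, p.@[u] != 0 /\ ED_corr X (pairpt x u).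
Proof.
move=> p0; have [g [g0 gP]] := Hd.
have [u] := mpoly_nonroot (mulf_neq0 p0 g0).
rewrite mevalM mulf_eq0 negb_or => /andP[pu /gP[[|x s] [_ sd sP]]].
  by move: Hdpos; rewrite -sd.
by exists u, x; split=> //; apply/sP; rewrite mem_head.
Qed.

Lemma ED_ideal_prime : prime_ideal I.
Proof.
apply: ED_incidence_prime HX _; apply: NNPP => ne.
have [u [x [_ Exu]]] := ED_corr_dominant (oner_neq0 _).
(* On an empty incidence set even the constant 1 vanishes, so the closure would be empty too. *)
have /eqP := Exu 1 (fun v Ev => False_ind _ (ne (ex_intro _ v Ev))).
by rewrite meval1 oner_eq0.
Qed.

Definition inU (p : {mpoly CC[n]}) : R := msubst (fun j => 'X_(rshift n j)) p.
Definition inX (p : {mpoly CC[n]}) : R := msubst (fun j => 'X_(lshift n j)) p.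

Lemma meval_inU p x u : (inU p).@[pairpt x u] = p.@[u].
Proof. by rewrite meval_msubst; apply: meval_eq => j; rewrite mevalXU pairptr. Qed.

Lemma meval_inX p v : (inX p).@[v] = p.@[fun j => v (lshift n j)].
Proof. by rewrite meval_msubst; apply: meval_eq => j; rewrite mevalXU. Qed.

Lemma ED_ideal_inU p : I (inU p) -> p = 0.
Proof.
move=> Ip; apply/eqP/negPn/negP => /ED_corr_dominant[u [x [pu Exu]]].
by rewrite -(meval_inU p x) Exu ?eqxx in pu.
Qed.

(** The tower from C[u] to C[x, u], adjoining one coordinate of [x] at a time so that
    [extend_derivation] applies at each stage. *)
Fixpoint partial_ring (js : seq 'I_n) : R -> Prop :=
  if js is i :: js' then adjoin (partial_ring js') 'X_(lshift n i)
  else fun z => exists p, z = inU p.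

Lemma partial_ring_subring js : subring (partial_ring js).
Proof.
elim: js => [|i js IH]; last exact: adjoin_subring.
split; first by exists 1; rewrite /inU -!mpolyC1 msubstC.
  move=> _ _ [p ->] [q ->]; exists (p - q).
  by rewrite /inU msubstB.
by move=> _ _ [p ->] [q ->]; exists (p * q); rewrite /inU msubstM.
Qed.

Lemma partial_ring_inU js p : partial_ring js (inU p).
Proof.
elim: js => [|i js IH]; first by exists p.
by apply: adjoin_sub IH; apply: partial_ring_subring.
Qed.

Lemma partial_ringX js i : i \in js -> partial_ring js 'X_(lshift n i).
Proof.
elim: js => // j js IH; rewrite inE => /predU1P[->|/IH Bi].
  by apply: adjoin_gen; apply: partial_ring_subring.
by apply: adjoin_sub Bi; apply: partial_ring_subring.
Qed.

Lemma partial_ring_mderiv js i z :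
  i \notin js -> partial_ring js z -> z^`M(lshift n i) = 0.
Proof.
elim: js z => [|j js IH] z.
  move=> _ [p ->]; rewrite /inU.
  rewrite (derivation_msubst _ _ (@mderiv_derivation _ _ (lshift n i))); last exact: mderivC.
  by rewrite big1 // => l _; rewrite mderivXU eq_rlshift mulr0.
rewrite inE negb_or => /andP[ne_ij ni] [q [Bq ->]].
rewrite (derivation_horner _ (mderiv_derivation _ (lshift n i)) (fun l => IH _ ni (Bq l))).
by rewrite mderivXU (inj_eq (@lshift_inj _ _)) eq_sym (negPf ne_ij) mulr0.
Qed.

Lemma partial_ring_full z : partial_ring (enum 'I_n) z.
Proof.
have sB := partial_ring_subring (enum 'I_n); have [_ _ BM] := sB.
elim/mpoly_ring_ind: z => [c|i|p q|p q]; [ | |exact: subringD|exact: BM].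
  by rewrite -(msubstC (fun j => 'X_(rshift n j)) c); apply: partial_ring_inU.
rewrite -(splitK i); case: (split i) => j /=.
  by apply: partial_ringX; rewrite mem_enum.
by rewrite -(msubstX (fun j => 'X_(rshift n j)) j); apply: partial_ring_inU.
Qed.

Lemma natr_not_ED_ideal k : ~ I k.+1%:R.
Proof.
have [_ I1 _ IM _] := ED_ideal_prime; move=> Ik; apply: I1.
have -> : 1 = (k.+1%:R^-1 : CC)%:MP * k.+1%:R :> R; last exact: IM.
by rewrite -mpolyC_nat -mpolyCM mulVf ?mpolyC1 // pnatr_eq0.
Qed.

(** Induction along the tower. The derivation by [u_j] works on C[u], which meets the ideal only in
    0. Adjoining [x_i] scales the field by some [s] outside the ideal and adds a multiple of the
    derivation by [x_i]; primality keeps the [u_j] component outside the ideal. *)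
Lemma ED_vecfield_partial (j : 'I_n) (js : seq 'I_n) : uniq js ->
  exists b : 'I_(n + n) -> R, [/\ ~ I (b (rshift n j)),
    forall i, i != j -> b (rshift n i) = 0 &
    forall z, partial_ring js z -> I z -> I (vecfield b z)].
Proof.
have [I0 I1 _ _ Ip] := ED_ideal_prime.
elim: js => [_|i js IH /= /andP[ni /IH[b [bj bi bI]]]].
  exists (fun l => (l == rshift n j)%:R); split=> [|i ne_ij|z [p ->] /ED_ideal_inU ->].
  - by rewrite eqxx.
  - by rewrite (inj_eq (@rshift_inj _ _)) (negPf ne_ij).
  by rewrite /inU -mpolyC0 msubstC vecfieldC.
have [s [w [sI swI]]] := extend_derivation (y := 'X_(lshift n i)) ED_ideal_prime
  natr_not_ED_ideal (partial_ring_subring js) (vecfield_derivation b)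
  (mderiv_derivation _ (lshift n i)) (fun z => @partial_ring_mderiv js i z ni)
  (etrans (mderivXU _ _ _) (congr1 (fun c : bool => c%:R) (eqxx (lshift n i)))) bI.
exists (fun l => s * b l + w * (l == lshift n i)%:R); split=> [|l ne_lj|z Bz Iz].
- by rewrite eq_rlshift mulr0 addr0 => /Ip[].
- by rewrite eq_rlshift mulr0 addr0 bi ?mulr0.
have -> : vecfield (fun l => s * b l + w * (l == lshift n i)%:R) z =
    s * vecfield b z + w * z^`M(lshift n i); last exact: swI.
rewrite /vecfield mulr_sumr.
rewrite (eq_bigr (fun l => s * (b l * z^`M(l)) + w * ((l == lshift n i)%:R * z^`M(l)))); last first.
  by move=> l _; ring.
rewrite big_split /=; congr (_ + _).
rewrite (bigD1 (lshift n i)) //= eqxx mul1r big1 ?addr0 // => l /negPf ->.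
by rewrite mul0r mulr0.
Qed.

Lemma ED_vecfield (j : 'I_n) :
  exists b : 'I_(n + n) -> R, [/\ ~ I (b (rshift n j)),
    forall i, i != j -> b (rshift n i) = 0 & forall z, I z -> I (vecfield b z)].
Proof.
have [b [bj bi bI]] := ED_vecfield_partial j (enum_uniq 'I_n).
by exists b; split=> // z; apply: bI; apply: partial_ring_full.
Qed.

Definition hpt (u : 'I_n -> CC) (t : CC) : 'I_n.+1 -> CC :=
  fun i => if unlift ord_max i is Some j then u j else t.

Lemma hpt_lift u t j : hpt u t (lift ord_max j) = u j.
Proof. by rewrite /hpt liftK. Qed.

Lemma hpt_max u t : hpt u t ord_max = t.
Proof. by rewrite /hpt unlift_none. Qed.

Definition rho : R := \sum_(i < n) ('X_(rshift n i) - 'X_(lshift n i)) ^+ 2.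

Lemma meval_rho x u : rho.@[pairpt x u] = sqdist u x.
Proof.
rewrite /rho raddf_sum; apply: eq_bigr => i _ /=.
by rewrite expr2 mevalM mevalB !mevalXU pairptl pairptr expr2.
Qed.

(** The coordinates of the map from [(x, u)] to [(u, R)], [R] being the squared distance, as
    polynomials; substituting them is pullback along this map. *)
Definition graph_vars : 'I_n.+1 -> R :=
  fun i => if unlift ord_max i is Some j then 'X_(rshift n j) else rho.

Lemma graph_vars_lift j : graph_vars (lift ord_max j) = 'X_(rshift n j).
Proof. by rewrite /graph_vars liftK. Qed.

Lemma graph_vars_max : graph_vars ord_max = rho.
Proof. by rewrite /graph_vars unlift_none. Qed.

Lemma meval_graph (F : {mpoly CC[n.+1]}) x u :
  (msubst graph_vars F).@[pairpt x u] = F.@[hpt u (sqdist u x)].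
Proof.
rewrite meval_msubst; apply: meval_eq => i; rewrite /graph_vars /hpt.
by case: (unlift _ _) => [j|]; rewrite ?meval_rho // mevalXU pairptr.
Qed.

(** On the incidence set [u - x] is a combination of gradients of equations [ps l] of [X]. Pairing
    with the [x] part of [b] gives the same combination of the [vecfield b (inX (ps l))], which
    vanish there because [inX (ps l)] lies in the ideal. *)
Lemma vecfield_normal (b : 'I_(n + n) -> R) :
  (forall z, I z -> I (vecfield b z)) ->
  I (\sum_(i < n) ('X_(rshift n i) - 'X_(lshift n i)) * b (lshift n i)).
Proof.
move=> bI v Ev; have [_ [k [ps [c [psX wE]]]]] := Ev.
rewrite raddf_sum /=.
have -> : \sum_(i < n) (('X_(rshift n i) - 'X_(lshift n i)) * b (lshift n i)).@[v] =
    \sum_(l < k) c l * (vecfield b (inX (ps l))).@[v].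
  rewrite (eq_bigr (fun i => \sum_(l < k) c l *
    (((ps l)^`M(i)).@[fun j => v (lshift n j)] * (b (lshift n i)).@[v]))); last first.
    move=> i _; rewrite mevalM mevalB !mevalXU wE mulr_suml.
    by apply: eq_bigr => l _; rewrite mulrA.
  rewrite exchange_big /=; apply: eq_bigr => l _; rewrite -mulr_sumr; congr (_ * _).
  rewrite /inX (derivation_msubst _ _ (vecfield_derivation b)); last exact: vecfieldC.
  rewrite raddf_sum; apply: eq_bigr => i _ /=.
  by rewrite vecfieldX mevalM; congr (_ * _); rewrite -/(inX _) meval_inX.
apply: big1 => l _; rewrite bI ?mulr0 // => v' Ev'; rewrite meval_inX.
by apply: psX; case: Ev' => -[].
Qed.

(* Along [E] the gradient of the squared distance [R] with respect to [u] is
   [2 (u - x)], since [u - x] is orthogonal to the variation of [x]; differentiating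
   [F (u, R) = 0] therefore determines [x] from [(u, R)]. *)
Lemma ED_gradient (F : {mpoly CC[n.+1]}) :
  (forall w, ED_hypersurface X w -> F.@[w] = 0) ->
  forall j x u, ED_corr X (pairpt x u) ->
    F^`M(lift ord_max j).@[hpt u (sqdist u x)] +
    F^`M(ord_max).@[hpt u (sqdist u x)] * (2 * (u j - x j)) = 0.
Proof.
move=> FE j x u Exu; have [_ _ ID IM Ip] := ED_ideal_prime.
have [b [bj bi bI]] := ED_vecfield j.
pose N := \sum_(i < n) ('X_(rshift n i) - 'X_(lshift n i)) * b (lshift n i).
pose H := msubst graph_vars F^`M(lift ord_max j) +
  msubst graph_vars F^`M(ord_max) * (2 * ('X_(rshift n j) - 'X_(lshift n j))).
(* Among the [u] directions only [u_j] contributes; the [x] directions are collected in [N], which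
   lies in the ideal. *)
have rhoE : vecfield b rho =
    2 * ('X_(rshift n j) - 'X_(lshift n j)) * b (rshift n j) - 2 * N.
  have [vD vM] := vecfield_derivation b.
  rewrite /rho derivation_sum; last exact: vecfield_derivation.
  rewrite (eq_bigr (fun i => 2 * (('X_(rshift n i) - 'X_(lshift n i)) * b (rshift n i))
    - 2 * (('X_(rshift n i) - 'X_(lshift n i)) * b (lshift n i)))); last first.
    move=> i _; rewrite expr2 vM vD -mulN1r vM !vecfieldX.
    by rewrite -mpolyC1 -mpolyCN vecfieldC mpolyCN mpolyC1; ring.
  rewrite sumrB -!mulr_sumr -/N; congr (_ - _); rewrite -mulrA; congr (_ * _).
  by rewrite (bigD1 j) //= big1 ?addr0 // => i ne_ij; rewrite bi ?mulr0.
have : I (vecfield b (msubst graph_vars F)).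
  apply: bI => v Ev; rewrite (pairpt_surj v) meval_graph; apply: FE => p; apply.
  exists (fun i => v (lshift n i)), (fun i => v (rshift n i)); split.
  - by rewrite -pairpt_surj; apply: ED_incidence_corr.
  - by move=> i; rewrite hpt_lift.
  - exact: hpt_max.
have -> : vecfield b (msubst graph_vars F) =
    b (rshift n j) * H - 2 * msubst graph_vars F^`M(ord_max) * N.
  rewrite (derivation_msubst _ _ (vecfield_derivation b)); last exact: vecfieldC.
  rewrite (bigD1 ord_max) //= graph_vars_max rhoE.
  rewrite (bigD1 (lift ord_max j)) /=; last by rewrite eq_sym neq_lift.
  rewrite (graph_vars_lift j).
  rewrite vecfieldX.
  rewrite big1 => [|i /andP[nmax nj]].
    rewrite /H addr0.
    move: (msubst _ _) (msubst _ _) (b _) (N) ('X_(rshift n j) - 'X_(lshift n j)).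
    by move=> A B s t a; ring.
  case: (unliftP ord_max i) nmax nj => [l ->|->]; last by rewrite eqxx.
  rewrite (inj_eq (@lift_inj _ _)) => _ ne_lj.
  by rewrite graph_vars_lift vecfieldX bi ?mulr0.
(* Modulo [N] the derivative of the pullback of [F] is the [u_j] component of [b] times [H]; that
   component is outside the prime ideal, so [H] is inside. *)
move=> Idiff; have /Ip[//|IH] : I (b (rshift n j) * H).
  rewrite -[_ * H](subrK (2 * msubst graph_vars F^`M(ord_max) * N)).
  by apply: ID => //; apply: IM; apply: vecfield_normal.
suff <- : H.@[pairpt x u] = F^`M(lift ord_max j).@[hpt u (sqdist u x)] +
    F^`M(ord_max).@[hpt u (sqdist u x)] * (2 * (u j - x j)) by exact: Exu.
rewrite /H mevalD mevalM; congr (_ + _ * _); try exact: meval_graph.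
by rewrite mevalM mevalB !mevalXU pairptl pairptr -mpolyC_nat mevalC.
Qed.

End Tangent.

(** * Counting the roots of the ED polynomial *)

Section MuniCoefficients.

Variable n : nat.

Definition mnm_join (m : 'X_{1..n}) (k : nat) : 'X_{1..n.+1} :=
  (mnmwiden m + U_(ord_max) *+ k)%MM.

(** Spelled with [widen_ord] to match the exponents produced by [muniE]. *)
Definition mnm_left (m : 'X_{1..n.+1}) : 'X_{1..n} :=
  [multinom m (widen_ord (leqnSn n) i) | i < n].

Lemma mnm_join_lift m k j : mnm_join m k (lift ord_max j) = m j.
Proof.
rewrite mnmDE mulmnE mnmE (negPf (neq_lift _ _)) mul0n addn0.
by rewrite -widen_lift_max mnmwiden_widen.
Qed.

Lemma mnm_join_max m k : mnm_join m k ord_max = k.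
Proof. by rewrite mnmDE mnmwiden_ordmax mulmnE mnmE eqxx mul1n. Qed.

Lemma mnm_joinE m m' k : (m' == mnm_join m k) = (mnm_left m' == m) && (k == m' ord_max).
Proof.
apply/eqP/andP=> [->|[/eqP <- /eqP ->]].
  split; apply/eqP; last by rewrite mnm_join_max.
  by apply/mnmP=> i; rewrite mnmE widen_lift_max mnm_join_lift.
apply/mnmP=> i; case: (unliftP ord_max i) => [j ->|->]; last by rewrite mnm_join_max.
by rewrite mnm_join_lift mnmE widen_lift_max.
Qed.

Lemma mcoeff_muni (K : idomainType) (p : {mpoly K[n.+1]}) k m :
  ((muni p)`_k)@_m = p@_(mnm_join m k).
Proof.
rewrite muniE coef_sum raddf_sum /= [in RHS](mpolyE p) raddf_sum /=.
apply: eq_bigr => m' _; rewrite coefZ coefXn mcoeffZ mcoeffX mnm_joinE -/(mnm_left m').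
case: eqP => _; rewrite ?andbF ?mulr0 ?mcoeff0 ?andbT ?mulr1 //.
by rewrite mcoeffZ mcoeffX.
Qed.

Lemma deg_in_muni (p : {mpoly CC[n.+1]}) : deg_in ord_max p = (size (muni p)).-1.
Proof.
apply/eqP; rewrite eqn_leq; apply/andP; split.
  apply/bigmax_leqP_seq => m mp _.
  have : (muni p)`_(m ord_max) != 0.
    apply: contraTneq mp => c0; rewrite mcoeff_msupp negbK.
    have := mcoeff_muni p (m ord_max) (mnm_left m); rewrite c0 mcoeff0.
    suff -> : mnm_join (mnm_left m) (m ord_max) = m by move=> <-.
    by apply/eqP; rewrite eq_sym mnm_joinE !eqxx.
  apply: contraR; rewrite -ltnNge => lt_m; apply/eqP; apply: nth_default.
  by move: lt_m; case: (size _).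
have [->|f0] := eqVneq (muni p) 0; first by rewrite size_poly0.
have : lead_coef (muni p) != 0 by rewrite lead_coef_eq0.
rewrite -msupp_eq0; case E : (msupp _) => [|m s] // _.
have : m \in msupp (lead_coef (muni p)) by rewrite E mem_head.
rewrite mcoeff_msupp lead_coefE mcoeff_muni -mcoeff_msupp => mp.
by rewrite -{1}(mnm_join_max m (size (muni p)).-1) /deg_in; apply: leq_bigmax_seq.
Qed.

End MuniCoefficients.

Lemma muni_ED_poly (n : nat) (F : {mpoly CC[n.+1]}) :
  muni (ED_poly F) = muni F \Po 'X^2.
Proof.
rewrite /ED_poly; elim/mpoly_ring_ind: F => [c|i|p q IHp IHq|p q IHp IHq].
- by rewrite comp_mpolyC muniC comp_polyC.
- rewrite comp_mpolyXU -tnth_nth tnth_mktuple.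
  case: (unliftP ord_max i) => [j ->|->].
    by rewrite eq_sym (negPf (neq_lift _ _)) muniXlift comp_polyC.
  by rewrite eqxx expr2 muniM muniXmax comp_polyX expr2.
- by rewrite comp_mpolyD !muniD comp_polyD; apply: (congr2 _ IHp IHq).
- by rewrite rmorphM /= !muniM comp_polyM; apply: (congr2 _ IHp IHq).
Qed.

Lemma deg_in_ED_poly (n : nat) (F : {mpoly CC[n.+1]}) :
  deg_in ord_max (ED_poly F) = (2 * (size (muni F)).-1)%N.
Proof. by rewrite deg_in_muni muni_ED_poly size_comp_poly size_polyXn mulnC. Qed.

(** This makes the values of [p] along a rational map accessible to polynomial vanishing
    arguments. *)
Lemma clear_denominators (k l : nat) (N : 'I_k -> {mpoly CC[l]})
    (H : {mpoly CC[l]}) (p : {mpoly CC[k]}) :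
  exists (Q : {mpoly CC[l]}) e, forall w, H.@[w] != 0 ->
    Q.@[w] = H.@[w] ^+ e * p.@[fun i => (N i).@[w] / H.@[w]].
Proof.
elim/mpoly_ring_ind: p => [c|i|p q [P [e PE]] [Q [f QE]]|p q [P [e PE]] [Q [f QE]]].
- by exists c%:MP, 0%N => w _; rewrite !mevalC expr0 mul1r.
- by exists (N i), 1%N => w H0; rewrite mevalXU expr1 mulrCA divff ?mulr1.
- exists (H ^+ f * P + H ^+ e * Q), (e + f)%N => w H0.
  rewrite [LHS]mevalD [in LHS]mevalM [in LHS]mevalM !rmorphXn /= PE // QE // mevalD exprD; ring.
- exists (P * Q), (e + f)%N => w H0; rewrite [LHS]mevalM PE // QE // mevalM exprD; ring.
Qed.

Lemma coprime_deriv_roots (K : closedFieldType) (f : {poly K}) :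
  f != 0 -> coprimep f f^`() ->
  exists rs : seq K, [/\ uniq rs, size rs = (size f).-1 & forall t, (t \in rs) = root f t].
Proof.
move=> f0; have [rs fE] := closed_field_poly_normal f.
have lf0 : lead_coef f != 0 by rewrite lead_coef_eq0.
rewrite {1 2}fE derivZ coprimepZl // coprimepZr // => co.
exists rs; split=> [||t].
- by rewrite -separable_prod_XsubC separable_poly.unlock.
- by rewrite fE size_scale // size_prod_XsubC.
- by rewrite fE rootZ // root_prod_XsubC.
Qed.

(** * The generic fiber and the roots of the specialized polynomial *)

Section Degree.

Variables (n : nat) (X : ('I_n -> CC) -> Prop) (d : nat) (F : {mpoly CC[n.+1]}).
Hypotheses (HX : irreducible_variety X) (Hd : EDdeg_is X d) (Hdpos : (0 < d)%N).
Hypothesis HF : is_ED_defining_poly X F.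

Lemma hpt_eta (w : 'I_n.+1 -> CC) : hpt (fun j => w (lift ord_max j)) (w ord_max) = w.
Proof.
apply: functional_extensionality => i.
by case: (unliftP ord_max i) => [j ->|->]; rewrite ?hpt_lift ?hpt_max.
Qed.

Lemma meval_hpt (G : {mpoly CC[n.+1]}) u t :
  G.@[hpt u t] = (map_poly (meval u) (muni G)).[t].
Proof.
rewrite meval_muni hpt_max; congr (_.[_]); apply: eq_map_poly => c.
by apply: meval_eq => i; rewrite hpt_lift.
Qed.

Lemma F_vanishes x u : ED_corr X (pairpt x u) -> F.@[hpt u (sqdist u x)] = 0.
Proof.
move=> Exu; apply/(proj2 HF) => p; apply; exists x, u; split=> //.
  by move=> j; rewrite hpt_lift.
exact: hpt_max.
Qed.

(** The product [G * Q] vanishes on the whole image of the correspondence, hence on its closure,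
    which is the zero set of [F]. *)
Lemma vanish_off (G Q : {mpoly CC[n.+1]}) :
  (forall x u, ED_corr X (pairpt x u) -> G.@[hpt u (sqdist u x)] != 0 ->
     Q.@[hpt u (sqdist u x)] = 0) ->
  forall w, F.@[w] = 0 -> G.@[w] != 0 -> Q.@[w] = 0.
Proof.
move=> QV w /(proj2 HF)/(_ (G * Q)) GQ Gw; have : (G * Q).@[w] = 0.
  apply: GQ => w' [x [u [Exu wl wm]]].
  have -> : w' = hpt u (sqdist u x).
    rewrite -(hpt_eta w') wm; congr (hpt _ _); exact: functional_extensionality.
  rewrite mevalM; have [->|G0] := eqVneq (G.@[hpt u (sqdist u x)]) 0; first by rewrite mul0r.
  by rewrite QV ?mulr0.
by rewrite mevalM => /eqP; rewrite mulf_eq0 (negPf Gw) => /eqP.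
Qed.

Lemma F_neq0 : F != 0.
Proof. by case: HF => -[sF _] _; apply: contraTneq sF => ->; rewrite msize0. Qed.

Lemma muniF_neq0 : muni F != 0.
Proof.
apply: contra_neq F_neq0 => f0; rewrite -(muniK F) f0.
by rewrite /unim map_poly0 horner0.
Qed.

(** Otherwise [F] would be a nonzero polynomial in [u] alone vanishing on the correspondence,
    against dominance. *)
Lemma size_muniF : (1 < size (muni F))%N.
Proof.
rewrite ltnNge; apply/negP=> /size1_polyC fE.
have [|u [x [cu Exu]]] := ED_corr_dominant Hd Hdpos (p := (muni F)`_0).
  by apply: contra_neq muniF_neq0 => c0; rewrite fE c0.
have := F_vanishes Exu; rewrite meval_hpt fE map_polyC hornerC /= => /eqP.
by rewrite (negPf cu).
Qed.

(* [h] is a denominator for the discriminant of [F]; away from [h = 0] a point [x]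
   of the fiber over [u] is the value [N / (2 h)] at [(u, R)]. *)
Lemma ED_inverse : exists (h : {mpoly CC[n]}) (N : 'I_n -> {mpoly CC[n.+1]}) a b,
  [/\ h != 0, h%:P = a * muni F + b * (muni F)^`() &
    forall x u j, ED_corr X (pairpt x u) -> h.@[u] != 0 ->
      x j = (N j).@[hpt u (sqdist u x)] / (2 * h.@[u])].
Proof.
(* In characteristic 0 a zero derivative kills all coefficients of positive index. *)
have f'0 : (muni F)^`() != 0.
  apply: contraTneq size_muniF => f'0; rewrite -leqNgt; apply/leq_sizeP=> k k0.
  have := coef_deriv (muni F) k.-1; rewrite f'0 coef0 prednK // => /esym/eqP.
  rewrite -mulr_natr mulf_eq0 -mpolyC_nat mpolyC_eq0 pnatr_eq0.
  by case: (k) k0 => // m _; rewrite orbF => /eqP.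
have fP : prime_elt (muni F).
  apply: prime_elt_iso (@muniK n CC) (@unimK n CC) _ (irreducible_mpoly_prime _).
  by case: HF.
have [h [a [b [h0 hE]]]] := prime_coprime_deriv fP f'0.
(* Where [F = 0], [h] equals [b] times the derivative of [F] in [R]. Multiplying the gradient
   relation by [b] gives [2 h (u_j - x_j) + b dF/du_j = 0], which is solved for [2 h x_j]. *)
exists h, (fun j => 2 * mwiden h * 'X_(lift ord_max j) + unim b * F^`M(lift ord_max j)), a, b.
split=> // x u j Exu hu; set t := sqdist u x.
have grad := ED_gradient HX Hd Hdpos (fun w => proj2 (proj2 HF w)) j Exu.
rewrite -/t in grad; have Ft := F_vanishes Exu; rewrite -/t in Ft.
have hw : (mwiden h).@[hpt u t] = h.@[u].
  by rewrite meval_hpt muni_mwiden map_polyC hornerC.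
have hb : h.@[u] = (unim b).@[hpt u t] * F^`M(ord_max).@[hpt u t].
  have hF : mwiden h = unim a * F + unim b * F^`M(ord_max).
    rewrite -unimC hE unimD unimM unimM -muni_mderiv_max.
    by congr (_ * _ + _ * _); exact: muniK.
  have mul0 (A B C : CC) : A = 0 -> B * A + C = C by move=> ->; rewrite mulr0 add0r.
  by rewrite -hw hF mevalD mevalM mevalM; apply: mul0.
have two0 : (2 : CC) != 0 by rewrite pnatr_eq0.
apply: (mulIf (mulf_neq0 two0 hu)); rewrite divfK ?mulf_neq0 //.
rewrite mevalD mevalM mevalM mevalM hw mevalXU hpt_lift -mpolyC_nat mevalC.
apply/eqP; rewrite -subr_eq0; apply/eqP.
move: grad hb; move: (F^`M(lift ord_max j).@[_]) (F^`M(ord_max).@[_]) => fj fm.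
move: ((unim b).@[_]) h.@[u] => bu hu' grad hb.
transitivity (- (bu * (fj + fm * (2 * (u j - x j))))); last by rewrite grad mulr0 oppr0.
rewrite hb; ring.
Qed.

Lemma size_muniF_EDdeg : (size (muni F)).-1 = d.
Proof.
have [h [N [a [b [h0 hE NE]]]]] := ED_inverse.
have [g [g0 gP]] := Hd.
set f := muni F in hE *.
have lf0 : lead_coef f != 0 by rewrite lead_coef_eq0 muniF_neq0.
(* Generic [u]: [g] controls the fiber count, [h] gives simple roots and the inverse, and the
   leading coefficient keeps the degree under specialization. *)
have [u] := mpoly_nonroot (mulf_neq0 (mulf_neq0 g0 h0) lf0).
rewrite mevalM mevalM mulf_eq0 mulf_eq0 !negb_or => /andP[/andP[gu hu] lu].
have [s [us <- sP]] := gP u gu.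
set fu := map_poly (meval u) f.
have sfu : size fu = size f by rewrite /fu size_map_poly_id0.
have FE t : F.@[hpt u t] = fu.[t] := meval_hpt F u t.
have fu0 : fu != 0 by rewrite -size_poly_gt0 sfu size_poly_gt0 muniF_neq0.
have hfu : map_poly (meval u) a * fu + map_poly (meval u) b * fu^`() = (h.@[u])%:P.
  have -> : (h.@[u])%:P = map_poly (meval u) h%:P by rewrite map_polyC.
  by rewrite hE rmorphD rmorphM rmorphM /fu deriv_map.
(* The Bezout relation specializes to a nonzero constant [h(u)], so the roots of [fu] are simple. *)
have [|rs [urs srs rootE]] := coprime_deriv_roots fu0.
  apply/Bezout_eq1_coprimepP.
  exists ((h.@[u])^-1 *: map_poly (meval u) a, (h.@[u])^-1 *: map_poly (meval u) b).
  by rewrite -scalerAl -scalerAl -scalerDr hfu -mul_polyC -polyCM mulVf.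
rewrite sfu in srs.
transitivity (size rs); first exact/esym.
rewrite -(size_map (fun x : {ffun 'I_n -> CC} => sqdist u x) s).
apply: perm_size; rewrite perm_sym; apply: uniq_perm => //.
  (* Injectivity: [u] and the squared distance determine [x] by the inverse formula. *)
  rewrite map_inj_in_uniq // => x y /sP Ex /sP Ey e; apply/ffunP=> j.
  by rewrite (NE x u j) // (NE y u j) // e.
move=> t; rewrite rootE /root -FE; apply/mapP/eqP => [[x /sP Ex ->]|Ft]; first exact: F_vanishes.
pose H := 2 * mwiden h.
have HE u' t' : H.@[hpt u' t'] = 2 * h.@[u'].
  by rewrite /H mevalM -mpolyC_nat mevalC meval_hpt muni_mwiden map_polyC hornerC.
have two0 : (2 : CC) != 0 by rewrite pnatr_eq0.
have Hut : H.@[hpt u t] != 0 by rewrite HE mulf_neq0.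
(* Numerators over the common denominator [H = 2 h] for the coordinates of [(x, u)] as rational
   functions of [(u, R)]. *)
pose M (i : 'I_(n + n)) := match split i with
  | inl j => N j | inr j => H * 'X_(lift ord_max j) end.
pose x := [ffun j => (N j).@[hpt u t] / (2 * h.@[u])].
have ME x' u' t' : (forall j, x' j = (N j).@[hpt u' t'] / (2 * h.@[u'])) ->
    H.@[hpt u' t'] != 0 -> (fun i => (M i).@[hpt u' t'] / H.@[hpt u' t']) =1 pairpt x' u'.
  move=> x'E H0 i; rewrite /M /pairpt; case: (split i) => j; first by rewrite x'E HE.
  by rewrite mevalM mevalXU hpt_lift mulrAC divff // mul1r.
have fiber x' u' : ED_corr X (pairpt x' u') -> H.@[hpt u' (sqdist u' x')] != 0 ->
    (fun i => (M i).@[hpt u' (sqdist u' x')] / H.@[hpt u' (sqdist u' x')]) =1 pairpt x' u'.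
  move=> Ex' H0; apply: (ME _ _ _ _ H0) => j; apply: (NE _ _ _ Ex').
  by move: H0; rewrite HE mulf_eq0 negb_or => /andP[].
have xE j : x j = (N j).@[hpt u t] / (2 * h.@[u]) by rewrite ffunE.
have Mx := ME x u t xE Hut.
(* An identity valid on the correspondence passes to the candidate over the root [t]: with
   denominators cleared it vanishes on the image off [H = 0], hence at every zero of [F] with [H]
   nonzero. *)
have val0 (p : {mpoly CC[n + n]}) (c : {mpoly CC[n.+1]}) :
    (forall x' u', ED_corr X (pairpt x' u') -> p.@[pairpt x' u'] = c.@[hpt u' (sqdist u' x')]) ->
    p.@[pairpt x u] = c.@[hpt u t].
  move=> pc; have [Q [e QE]] := clear_denominators M H p.
  have : (Q - H ^+ e * c).@[hpt u t] = 0.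
    apply: vanish_off Ft Hut => x' u' Ex' H0.
    rewrite mevalB mevalM rmorphXn /= QE // (meval_eq _ (fiber x' u' Ex' H0)) pc //.
    by rewrite subrr.
  rewrite mevalB mevalM rmorphXn /= QE // (meval_eq _ Mx) -mulrBr => /eqP.
  by rewrite mulf_eq0 expf_eq0 (negPf Hut) andbF subr_eq0 => /eqP.
(* Taking [c = 0] shows that every polynomial in the ideal vanishes at the candidate, which thus
   lies in the fiber. *)
exists x.
  apply/sP => p pI; rewrite (val0 p 0) ?meval0 // => x' u' Ex'.
  by rewrite meval0; apply: Ex'.
(* The same transfer for the squared distance shows that the candidate maps to [t]. *)
have := val0 (rho n) 'X_ord_max; rewrite meval_rho mevalXU hpt_max => ->// x' u' _.
by rewrite meval_rho mevalXU hpt_max.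
Qed.

End Degree.

Theorem mainTheorem5 (n : nat) (X : ('I_n -> CC) -> Prop) (d : nat)
  (HX : irreducible_variety X) (Hd : EDdeg_is X d) (Hdpos : (0 < d)%N)
  (F : {mpoly CC[n.+1]}) (HF : is_ED_defining_poly X F) :
  deg_in ord_max (ED_poly F) = (2 * d)%N.
Proof. by rewrite deg_in_ED_poly (size_muniF_EDdeg HX Hd Hdpos HF). Qed.
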